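(* Let $\mathcal X=\{x\in\mathbb R^d: Ax\le b\}$ be a nonempty bounded polytope, $P_c$ a probability distribution on $\mathbb R^d$, $\rho,\delta_0\in(0,1)$, and $n_1\ge 1$. Let $\widehat{\mathcal C}$ be a $(\rho,\delta_0)$-estimated prior (built from a pilot sample) that is independent of the representation-learning sample. On the event $\mathcal E_0:=\{P_c(c\notin\widehat{\mathcal C})\le\rho\}$ let $P_{\widehat{\mathcal C}}:=P_c(\cdot\mid c\in\widehat{\mathcal C})$ and $\widehat d_\star:=\dim\operatorname{dir}(\mathcal X^\star(\widehat{\mathcal C}))$; select $\widehat c_0\in\widehat{\mathcal C}$ and an anchor $\widehat x_0\in\mathcal X^\star(\widehat c_0)\subseteq\mathcal X^\star(\widehat{\mathcal C})$, chosen independently of the representation-learning sample given the pilot. Run the sample-based learning algorithm (described in the context) with anchor $\widehat x_0$ on the first $n_1$ samples of the i.i.d. representation-learning sample from $P_c$ that fall inside $\widehat{\mathcal C}$ (conditional on the realized $\widehat{\mathcal C}$ and on retaining $n_1$ samples, these are i.i.d. from $P_{\widehat{\mathcal C}}$), and let $U_{n_1}$ be the output matrix. Then for any $\delta_1\in(0,1)$, with probability at least $1-\delta_0-\delta_1$ over the pilot and retained representation-learning samples, $$\mathbb P_{c\sim P_c}\!\left[\mathsf{Exact}(U_{n_1},\widehat x_0,c)\right]\ \ge\ 1-\rho-\frac{4}{n_1}\bigl(6\widehat d_\star+\log(e/\delta_1)\bigr),$$ where $c\sim P_c$ is a fresh draw. Consequently, the same guarantee holds, for every distribution $P_c$, when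 $\widehat{\mathcal C}=\widehat{\mathcal C}_{\rho,\delta_0}$ is the tolerance-calibrated set defined in the context.
   Context: For $c\in\mathbb R^d$, $\mathcal X^\star(c):=\operatorname*{arg\,min}_{x\in\mathcal X}c^\top x$ (the set of all minimizers); for $\mathcal C\subseteq\mathbb R^d$, $\mathcal X^\star(\mathcal C):=\bigcup_{c\in\mathcal C}\mathcal X^\star(c)$. $\mathcal X^\angle$ is the set of extreme points of $\mathcal X$. For $S\subseteq\mathbb R^d$, $\operatorname{dir}(S):=\operatorname{span}\{x-x':x,x'\in S\}$. Estimated prior: a pilot-measurable random convex set $\widehat{\mathcal C}\subseteq\mathbb R^d$ is a $(\rho,\delta_0)$-estimated prior if $\mathbb P_{\rm pilot}[P_c(c\notin\widehat{\mathcal C})\le\rho]\ge1-\delta_0$. For $x_0\in\mathcal X$ and $U\in\mathbb R^{d\times r}$ with linearly independent columns ($r=0$ allowed, with $\operatorname{range}(U)=\{0\}$): $T_{U,x_0}(z):=x_0+Uz$; $\mathcal Z_{U,x_0}:=\{z\in\mathbb R^r: T_{U,x_0}(z)\in\mathcal X\}$; $F_{U,x_0}(c):=\operatorname*{arg\,min}_{z\in\mathcal Z_{U,x_0}}(U^\top c)^\top z$. $\mathsf{Exact}(U,x_0,c)$ is the statement $\mathcal X^\star(c)=T_{U,x_0}(F_{U,x_0}(c))$. Sample-based learning algorithm. Input: $\mathcal X$, a fixed anchor $x_0$, a sequence of costs $c_1,\dots,c_n$, and a fixed deterministic (measurable) tie-breaking rule, by which every choice below is a function of the current cost and the current matrix.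 Initialize $U_0$ as the empty $d\times 0$ matrix. For $i=1,\dots,n$: set $U_i\leftarrow U_{i-1}$; while $\mathcal X^\star(c_i)\not\subseteq x_0+\operatorname{range}(U_i)$, choose $x\in\mathcal X^\star(c_i)\cap\mathcal X^\angle$ with $x-x_0\notin\operatorname{range}(U_i)$ and append $x-x_0$ as a new column of $U_i$. Output $U_n$. Tolerance-calibrated set $\widehat{\mathcal C}_{\rho,\delta_0}$: split an i.i.d. pilot sample from $P_c$ into independent parts, a fitting sample $\mathcal D_{\rm fit}$ and a calibration sample $c^{\rm cal}_1,\dots,c^{\rm cal}_m$. Using only $\mathcal D_{\rm fit}$, fit a measurable score $s_{\widehat\theta}:\mathbb R^d\to\mathbb R$ all of whose sublevel sets $\{c:s_{\widehat\theta}(c)\le t\}$ are convex. Let $S_j=s_{\widehat\theta}(c^{\rm cal}_j)$ with order statistics $S_{(1)}\le\dots\le S_{(m)}$ and $S_{(m+1)}:=+\infty$. Set $k_{\rho,\delta_0}:=\min\{k\in\{1,\dots,m+1\}:\mathbb P[\operatorname{Bin}(m,1-\rho)\ge k]\le\delta_0\}$ and $\widehat{\mathcal C}_{\rho,\delta_0}:=\{c\in\mathbb R^d:s_{\widehat\theta}(c)\le S_{(k_{\rho,\delta_0})}\}$ (all of $\mathbb R^d$ if $k_{\rho,\delta_0}=m+1$). *)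

(* Defs.v *)
From HB Require Import structures.
From mathcomp Require Import all_boot all_order all_algebra.
From mathcomp Require Import all_classical all_reals all_analysis.

Set Implicit Arguments.
Unset Strict Implicit.
Unset Printing Implicit Defensive.

Import Order.TTheory GRing.Theory Num.Theory.
Import numFieldNormedType.Exports.

Local Open Scope classical_set_scope.
Local Open Scope ring_scope.

Section borel_matrix.
Context {R : realType} {m n : nat}.

Definition mx_borel : set (set 'M[R]_(m, n)) := <<s [set U | open U] >>.

Let mx_borel0 : mx_borel set0.
Proof. exact: sigma_algebra0. Qed.

Let mx_borelC A : mx_borel A -> mx_borel (~` A).
Proof. exact: sigma_algebraC. Qed.

Let mx_borel_bigcup (F : (set 'M[R]_(m, n))^nat) :
  (forall i, mx_borel (F i)) -> mx_borel (\bigcup_i F i).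
Proof. exact: sigma_algebra_bigcup. Qed.

HB.instance Definition _ := @isMeasurable.Build default_measure_display
  'M[R]_(m, n) mx_borel mx_borel0 mx_borelC mx_borel_bigcup.

End borel_matrix.

Section linear_programs.
Context {R : realType} {d : nat}.
Implicit Types (X : set 'cV[R]_d) (c x : 'cV[R]_d).

Definition polyhedron {p : nat} (A : 'M[R]_(p, d)) (b : 'cV[R]_p)
    : set 'cV[R]_d :=
  [set x | forall i, (A *m x) i 0 <= b i 0].

Definition dot {r : nat} (c x : 'cV[R]_r) : R := (c^T *m x) 0 0.

Definition argmin {T : Type} (S : set T) (f : T -> R) : set T :=
  [set x | S x /\ forall y, S y -> f x <= f y].

Definition Xstar X c : set 'cV[R]_d := argmin X (dot c).

Definition Xstar_set X (C : set 'cV[R]_d) : set 'cV[R]_d :=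
  \bigcup_(c in C) Xstar X c.

Definition extreme X : set 'cV[R]_d :=
  [set x | X x /\ forall y z (t : R), X y -> X z -> 0 < t < 1 ->
     x = t *: y + (1 - t) *: z -> y = x /\ z = x].

Definition is_span (D : set 'cV[R]_d) (V : {vspace 'cV[R]_d}) : Prop :=
  (forall x, D x -> x \in V) /\
  (forall V' : {vspace 'cV[R]_d}, (forall x, D x -> x \in V') -> (V <= V')%VS).

(* The linear span of an arbitrary, possibly infinite, set, i.e. the least
   subspace containing it. The default 0 is never used, by [spanP]. *)
Definition span_set (D : set 'cV[R]_d) : {vspace 'cV[R]_d} :=
  xget 0%VS (is_span D).

Lemma spanP (D : set 'cV[R]_d) : is_span D (span_set D).
Proof.
rewrite /span_set; case: xgetP => // nospan.
suff [V] : exists V, is_span D V by move/nospan.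
pose Q k := `[< exists2 s : seq 'cV[R]_d,
  (forall x, x \in s -> D x) & \dim (span s) = k >].
have Q0 : exists k, Q k.
  by exists 0%N; apply/asboolP; exists [::]; rewrite ?span_nil ?dimv0.
have Qd k : Q k -> (k <= \dim {:'cV[R]_d})%N.
  by move=> /asboolP[s _ <-]; rewrite dimvS ?subvf.
case: (ex_maxnP Q0 Qd) => k /asboolP[s sD sk] kmax.
exists (span s); split => [x Dx|V' DV'].
  have /eqP : span s == span (x :: s).
    rewrite eqEdim; apply/andP; split.
      by apply: sub_span => y ys; rewrite inE ys orbT.
    rewrite sk kmax//; apply/asboolP; exists (x :: s) => // y.
    by rewrite inE => /predU1P[->//|/sD].
  by move=> ->; apply: memv_span; rewrite inE eqxx.
by apply/span_subvP => x /sD /DV'.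
Qed.

Definition dir (S : set 'cV[R]_d) : {vspace 'cV[R]_d} :=
  span_set [set u | exists x x', [/\ S x, S x' & u = x - x']].

End linear_programs.

Section reduction.
Context {R : realType} {d : nat} (X : set 'cV[R]_d).

Definition affine_map {r : nat} (U : 'M[R]_(d, r)) (x0 : 'cV[R]_d)
    (z : 'cV[R]_r) : 'cV[R]_d :=
  x0 + U *m z.

Definition Zset {r : nat} (U : 'M[R]_(d, r)) x0 : set 'cV[R]_r :=
  [set z | X (affine_map U x0 z)].

Definition Fset {r : nat} (U : 'M[R]_(d, r)) x0 (c : 'cV[R]_d)
    : set 'cV[R]_r :=
  argmin (Zset U x0) (dot (U^T *m c)).

Definition Exact {r : nat} (U : 'M[R]_(d, r)) x0 c : Prop :=
  Xstar X c = affine_map U x0 @` Fset U x0 c.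

(* A tie-breaking rule [pick]: [pick x0 c U] is the solution chosen at the
   current cost [c] and the current matrix [U], for a run anchored at [x0]. *)
Definition rule : Type :=
  'cV[R]_d -> 'cV[R]_d -> forall r, 'M[R]_(d, r) -> 'cV[R]_d.

Definition tie_breaking (pick : rule) : Prop :=
  (forall r, measurable_fun
     [set: 'cV[R]_d * 'cV[R]_d * 'M[R]_(d, r)]
     (fun q => pick q.1.1 q.1.2 r q.2)) /\
  (forall x0 c r (U : 'M[R]_(d, r)), X x0 ->
     ~ (Xstar X c `<=` range (affine_map U x0)) ->
     [/\ Xstar X c (pick x0 c r U), extreme X (pick x0 c r U) &
         ~ range (mulmx U) (pick x0 c r U - x0)]).

Context (pick : rule) (x0 : 'cV[R]_d).

(* Big-step semantics of the while loop at the cost [c]: started from [U], the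
   loop terminates with [U']. *)
Inductive while_loop (c : 'cV[R]_d) :
    forall r, 'M[R]_(d, r) -> forall r', 'M[R]_(d, r') -> Prop :=
| while_stop r (U : 'M[R]_(d, r)) :
    Xstar X c `<=` range (affine_map U x0) -> while_loop c U U
| while_step r (U : 'M[R]_(d, r)) r' (U' : 'M[R]_(d, r')) :
    ~ (Xstar X c `<=` range (affine_map U x0)) ->
    while_loop c (row_mx U (pick x0 c U - x0)) U' ->
    while_loop c U U'.

Inductive for_loop :
    seq 'cV[R]_d ->
    forall r, 'M[R]_(d, r) -> forall r', 'M[R]_(d, r') -> Prop :=
| for_nil r (U : 'M[R]_(d, r)) : for_loop [::] U U
| for_cons c cs r (U : 'M[R]_(d, r)) r1 (U1 : 'M[R]_(d, r1))
    r' (U' : 'M[R]_(d, r')) :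
    while_loop c U U1 -> for_loop cs U1 U' -> for_loop (c :: cs) U U'.

Definition learns (cs : seq 'cV[R]_d) {r : nat} (U : 'M[R]_(d, r)) : Prop :=
  for_loop cs (0 : 'M[R]_(d, 0)) U.

End reduction.

Section independence.
Context {R : realType} {dO : measure_display} {Omega : measurableType dO}.
Context (P : probability Omega R).

Definition mutually_independent {I : eqType} {dT : measure_display}
    {T : measurableType dT} (X : I -> {RV P >-> T}) : Prop :=
  forall (J : seq I) (A : I -> set T), uniq J -> (forall i, measurable (A i)) ->
    P (\big[setI/setT]_(i <- J) (X i @^-1` A i)) =
    (\prod_(i <- J) fine (P (X i @^-1` A i)))%:E.

Definition iid {I : eqType} {dT : measure_display} {T : measurableType dT}
    (mu : probability T R) (X : I -> {RV P >-> T}) : Prop :=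
  mutually_independent X /\
  (forall i A, measurable A -> distribution P (X i) A = mu A).

Definition independent {d1 d2 : measure_display} {T1 : measurableType d1}
    {T2 : measurableType d2} (X : Omega -> T1) (Y : Omega -> T2) : Prop :=
  forall A B, measurable A -> measurable B ->
    P ((X @^-1` A) `&` (Y @^-1` B)) = (P (X @^-1` A) * P (Y @^-1` B))%E.

(* A sequence is a random element through its finite initial segments. *)
Definition independent_of_seq {d1 d2 : measure_display} {T1 : measurableType d1}
    {T2 : measurableType d2} (X : Omega -> T1) (Y : nat -> Omega -> T2) : Prop :=
  forall N, independent X (fun w => [tuple Y i w | i < N]).

(* [P E >= q], in a form that does not presuppose that [E] is measurable; it is
   equivalent to [P E >= q] when [E] is measurable. *)
Definition prob_ge (E : set Omega) (q : R) : Prop :=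
  exists2 F : set Omega, measurable F /\ F `<=` E & (q%:E <= P F)%E.

End independence.

(* [s] lists the first [size s] terms of the sequence [c] that fall in [C]. *)
Definition first_retained {T : Type} (C : set T) (c : nat -> T) (s : seq T)
    : Prop :=
  exists N, s = [seq x <- mkseq c N | x \in C].

Section guarantee.
Context {R : realType} {d : nat}.
Context (X : set 'cV[R]_d) (Pc : probability 'cV[R]_d R).
Context (rho delta0 : R).

Definition tolerance_event (C : set 'cV[R]_d) : Prop :=
  (Pc (~` C) <= rho%:E)%E.

(* The pilot is a random element [W], and [C] depends on it. Measurability of
   [C] is joint measurability of the membership relation. *)
Definition estimated_prior {dO dW : measure_display} {Omega : measurableType dO}
    {Wt : measurableType dW} (P : probability Omega R) (W : {RV P >-> Wt})
    (C : Wt -> set 'cV[R]_d) : Prop :=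
  [/\ measurable [set q : Wt * 'cV[R]_d | C q.1 q.2],
      forall w, convex_set (C w : set (convex_lmodType 'cV[R]_d)) &
      ((1 - delta0)%:E <= P [set w | tolerance_event (C (W w))])%E].

Definition error_bound (n1 : nat) (dstar : nat) (delta1 : R) : R :=
  4 / n1%:R * (6 * dstar%:R + ln (expR 1 / delta1)).

(* The anchor [x0] and the cost [c0] may use randomization beyond the pilot [W].
   As [W] is independent of the sample, conditional independence of [(c0, x0)]
   and the sample given [W] amounts to independence of [(W, c0, x0)] and the
   sample. The sample is an infinite sequence, so that [n1] terms are retained
   almost surely on [tolerance_event], and the retained terms given the pilot
   are then i.i.d. from [Pc] conditioned on [C]. The event contains the two
   conditions under which [U] is defined: [tolerance_event], and [n1] samples
   being retained. *)
Definition learning_guarantee (pick : @rule R d) (n1 : nat)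
    {dO dW : measure_display} {Omega : measurableType dO}
    {Wt : measurableType dW} (P : probability Omega R) (W : {RV P >-> Wt})
    (C : Wt -> set 'cV[R]_d) : Prop :=
  forall (c0 x0 : {RV P >-> 'cV[R]_d}) (cs : nat -> {RV P >-> 'cV[R]_d}),
    iid Pc cs ->
    independent_of_seq P (fun w => (W w, c0 w, x0 w)) cs ->
    (forall w, tolerance_event (C (W w)) ->
       C (W w) (c0 w) /\ Xstar X (c0 w) (x0 w)) ->
  forall delta1 : R, 0 < delta1 < 1 ->
  prob_ge P
    [set w | tolerance_event (C (W w)) /\
       exists s : n1.-tuple 'cV[R]_d,
         first_retained (C (W w)) (fun i => cs i w) s /\
         exists r (U : 'M[R]_(d, r)), learns X pick (x0 w) s U /\
           ((1 - rho -
             error_bound n1 (\dim (dir (Xstar_set X (C (W w))))) delta1)%:E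
            <= Pc [set c | Exact X U (x0 w) c])%E]
    (1 - delta0 - delta1).

End guarantee.

Section calibration.
Context {R : realType} {d : nat} (rho delta0 : R).

(* The minimum is over a nonempty set: [P[Bin(m, 1 - rho) >= m + 1] = 0]. *)
Definition k_cal (m : nat) : nat :=
  [arg min_(k < (ord_max : 'I_m.+2) | (0 < k)%N &&
     (binomial_prob m (1 - rho) [set j | (k <= j)%N] <= delta0%:E)%E) (k : nat)].

(* The default value of [nth] encodes [S_(m+1) = +oo]. *)
Definition order_stat (S : seq R) (k : nat) : \bar R :=
  nth +oo%E [seq x%:E | x <- sort <=%R S] k.-1.

Definition calibrated_set {m : nat} (s : 'cV[R]_d -> R)
    (cal : m.-tuple 'cV[R]_d) : set 'cV[R]_d :=
  [set c | ((s c)%:E <= order_stat [seq s x | x <- cal] (k_cal m))%E].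

End calibration.

(* Main.v *)
From HB Require Import structures.
Require Import Defs.
From mathcomp Require Import all_boot all_order all_algebra.
From mathcomp Require Import all_classical all_reals all_analysis.
From mathcomp Require Import measurable_realfun ring lra.
Import Order.TTheory GRing.Theory Num.Theory.
Import numFieldNormedType.Exports.
Local Open Scope classical_set_scope.
Local Open Scope ring_scope.

(** Write [G(U)] for the set of costs whose optimal solutions all lie in the
    affine slice [x0 + range U]. A nonempty polytope has an optimal solution
    for every cost, and then [Exact X U x0 c] says that [c] belongs to [G(U)]
    ([ExactP]). Call the other costs hard. Two facts drive the proof. Along a
    run the range only grows, so that the mass [e] of the hard costs inside the
    prior [C] only decreases ([risk_run_step]). And each retained hard cost adds
    at least one column, while the columns are independent vectors of the
    direction space of [X*(C)], so that there are at most [d*] of them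
    ([while_loop_iter], [independent_cols_le]). A run that ends with mass above
    [beta] has therefore met a hard cost with conditional probability above
    [beta] at each of its [n1] retained samples, and yet has met few of them.

    The resulting Chernoff bound is a supermartingale argument. With [r] columns
    and [n] retained samples, the quantity [2 ^ (k - r) exp (- beta (n1 - n) / 2)],
    set to 0 once [e <= beta] or [r > k], does not increase in mean under a fresh
    draw ([potential_drift]): a retained sample multiplies it by at most
    [exp (beta / 2)], and a hard one at least halves it in addition. A draw outside [C]
    leaves the state unchanged, so the law of the retained sample never has to be
    computed. Starting from [2 ^ k exp (- beta n1 / 2)] and worth 1 at the end of
    a run with exactly [k] columns and mass above [beta], the potential bounds the
    probability of the latter. For [beta k = 4 / n1 (6 k + log (e / delta1))] the
    bounds sum to at most [delta1] over all [k] ([potential_start_le], [bad_le]).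
    Taking the union over [k], and only then comparing the number of columns with
    [d*], keeps the good event measurable whatever way [d*] depends on the pilot.
    A second potential shows that [n1] samples end up being retained
    ([few_le]), and the mass [rho] outside the prior accounts for the rest
    ([Exact_ge]).

    Both potentials are integrated along a walk driven by samples that are fresh,
    that is, independent of the current state ([fresh], [integral_walk_le]).

    The calibrated set misses its tolerance only if its threshold is a level [t]
    with [P (s <= t) < 1 - rho]. The scores at such low levels have probability
    at most [1 - rho] in total ([low_score_prob]), and on a miss at least
    [k_cal] calibration scores are low ([calibrated_miss]). The conditional
    probability that this still happens, computed as if low scores had probability
    exactly [1 - rho], is again a supermartingale ([tail_potential_drift]), and
    its initial value is the binomial tail that defines [k_cal]. *)

Set Implicit Arguments.
Unset Strict Implicit.
Unset Printing Implicit Defensive.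

(** * Borel matrices *)

Section borel_matrices.
Context {R : realType}.

Lemma measurable_set_of {d} {T : measurableType d} (f : T -> bool) :
  measurable_fun [set: T] f -> measurable [set t | f t].
Proof.
move=> mf; rewrite [X in measurable X](_ : _ = [set: T] `&` f @^-1` [set true]).
  exact: mf.
by apply/seteqP; split => t /= => [ft|[]].
Qed.

(** Open intervals generate the Borel sets of the line, and their preimages are
    open. *)
Lemma continuous_measurable_mx m n (f : 'M[R]_(m, n) -> R) :
  continuous f -> measurable_fun [set: 'M[R]_(m, n)] f.
Proof.
move=> cf.
apply: (measurability _ (RGenOpens.measurableE R)).
move=> _ [_ [a [b ->] <-]]; rewrite setTI; apply: sub_sigma_algebra.
by move/continuousP: cf; apply; exact: interval_open.
Qed.

(** An open set of matrices is a countable union of boxes with rational centres,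
    and being in a box is a finite conjunction of conditions on coordinates. *)
Lemma measurable_fun_mx {dT} {T : measurableType dT} m n
    (f : T -> 'M[R]_(m, n)) :
  (forall i j, measurable_fun [set: T] (fun t => f t i j)) ->
  measurable_fun [set: T] f.
Proof.
move=> mf; apply: (measurability [set U : set 'M[R]_(m, n) | open U]) => //.
move=> _ [V oV <-]; rewrite setTI.
pose B (q : 'M[rat]_(m, n) * nat) : set 'M[R]_(m, n) :=
  [set M | forall i j, `|ratr (q.1 i j) - M i j| < q.2.+1%:R^-1].
have -> : f @^-1` V = \bigcup_(q in [set q | B q `<=` V]) (f @^-1` B q).
  apply/seteqP; split => [t /= Vft|t [q BV Bt]]; last exact: BV.
  have /nbhs_ballP[e /= e0 eV] : nbhs (f t) V by exact: open_nbhs_nbhs.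
  have [k ke] : exists k : nat, k.+1%:R^-1 < e / 2.
    have [k] : exists k : nat, 0 + k.+1%:R^-1 < e / 2.
      by apply: ltr_add_invr; rewrite divr_gt0.
    by rewrite add0r; exists k.
  have qex (i : 'I_m) (j : 'I_n) :
      exists q : rat, `|ratr q - f t i j| < k.+1%:R^-1.
    have [q] := @rat_in_itvoo R (f t i j) (f t i j + k.+1%:R^-1)
      ltac:(by rewrite ltrDl invr_gt0 ltr0n).
    rewrite in_itv /= => /andP[q1 q2]; exists q.
    by rewrite ger0_norm ?subr_ge0 1?ltW// ltrBlDl.
  pose q := \matrix_(i, j) sval (cid (qex i j)).
  exists (q, k) => [M BM|i j] /=; last by rewrite mxE; case: cid.
  apply: eV => /=; split=> // i j; rewrite /ball /=.
  have := BM i j; rewrite mxE /=; case: cid => p /= pf Mp; rewrite /ball_.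
  rewrite (_ : f t i j - M i j = - (ratr p - f t i j) + (ratr p - M i j));
    last by lra.
  apply: le_lt_trans (ler_normD _ _) _.
  by rewrite normrN [e]splitr ltrD// (lt_trans _ ke).
rewrite bigcup_mkcond.
apply: countable_bigcupT_measurable; first exact: countableP.
move=> q; case: ifP => // _.
have -> : f @^-1` B q = \bigcap_i \bigcap_j
    [set t | `|ratr (q.1 i j) - f t i j| < q.2.+1%:R^-1].
  by apply/seteqP; split => t /= Bt i => [_ j _|j]; exact: Bt.
apply: fin_bigcap_measurable => // i _; apply: fin_bigcap_measurable => // j _.
rewrite -[X in measurable X]setTI.
have mg : measurable_fun [set: T] (fun t => `|ratr (q.1 i j) - f t i j|).
  apply: measurableT_comp => //; exact: measurable_funB.
rewrite setTI.
apply: (@measurable_set_of _ _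
  (fun t => `|ratr (q.1 i j) - f t i j| < q.2.+1%:R^-1)).
exact: measurable_fun_ltr.
Qed.

(** This is how a matrix whose number of columns depends on the point is
    handled: each number of columns is treated separately. *)
Lemma measurable_fun_nat_case {d d'} {T : measurableType d}
    {Z : measurableType d'} (g : T -> nat) (f : nat -> T -> Z) :
  measurable_fun [set: T] g -> (forall n, measurable_fun [set: T] (f n)) ->
  measurable_fun [set: T] (fun t => f (g t) t).
Proof.
move=> mg mf _ B mB; rewrite setTI.
have -> : (fun t => f (g t) t) @^-1` B =
    \bigcup_n (g @^-1` [set n] `&` f n @^-1` B).
  apply/seteqP; split => t /=; first by move=> Bt; exists (g t).
  by move=> [n _ [/= ->]].
apply: bigcupT_measurable => n; apply: measurableI.
  by rewrite -[X in measurable X]setTI; exact: mg.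
by rewrite -[X in measurable X]setTI; exact: mf.
Qed.

Lemma closed_measurable_mx m n (F : set 'M[R]_(m, n)) :
  closed F -> measurable F.
Proof.
move=> cF; rewrite -[F]setCK; apply: measurableC.
by apply: sub_sigma_algebra; exact: closed_openC.
Qed.

Lemma closed_mx_ge m n (f : 'M[R]_(m, n) -> R) (a : R) :
  continuous f -> closed [set M | a <= f M].
Proof. by move=> cf; apply: (@closed_comp _ _ f [set x | a <= x]). Qed.

Lemma continuous_sum_mx m n (I : Type) (s : seq I)
    (f : I -> 'M[R]_(m, n) -> R) :
  (forall i, continuous (f i)) -> continuous (fun M => \sum_(i <- s) f i M).
Proof.
move=> cf; elim: s => [|i s IHs].
  rewrite (_ : (fun M => _) = cst 0); first exact: cst_continuous.
  by apply/funext => M; rewrite big_nil.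
rewrite (_ : (fun M => _) = f i \+ (fun M => \sum_(i <- s) f i M)).
  by move=> M; exact: (continuousD (cf i M) (IHs M)).
by apply/funext => M; rewrite big_cons.
Qed.

Lemma dotE r (c x : 'cV[R]_r) : dot c x = \sum_i c i 0 * x i 0.
Proof. by rewrite /dot mxE; apply: eq_bigr => i _; rewrite mxE. Qed.

Lemma dot_continuous_coord m n (f : 'M[R]_(m, n) -> 'cV[R]_m)
    (g : 'M[R]_(m, n) -> 'cV[R]_m) :
  (forall i, continuous (fun M => f M i 0)) ->
  (forall i, continuous (fun M => g M i 0)) ->
  continuous (fun M => dot (f M) (g M)).
Proof.
move=> cf cg; under eq_fun do rewrite dotE.
by apply: continuous_sum_mx => i M; exact: (continuousM (cf i M) (cg i M)).
Qed.

Lemma measurable_coord m n (i : 'I_m) (j : 'I_n) :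
  measurable_fun [set: 'M[R]_(m, n)] (fun M => M i j).
Proof. by apply: continuous_measurable_mx => M; exact: coord_continuous. Qed.

Lemma measurable_row_mx m n1 n2 :
  measurable_fun [set: 'M[R]_(m, n1) * 'M[R]_(m, n2)]
    (fun q => row_mx q.1 q.2).
Proof.
apply: measurable_fun_mx => i j; case: (split_ordP j) => k ->.
  under eq_fun do rewrite row_mxEl.
  exact: (measurableT_comp (measurable_coord i k) measurable_fst).
under eq_fun do rewrite row_mxEr.
exact: (measurableT_comp (measurable_coord i k) measurable_snd).
Qed.

(** For a fixed competitor [y] the condition is closed in [(c, x)], and closed
    conditions may be intersected over uncountably many [y]. The pair is glued
    into one matrix, for which closed sets are measurable. *)
Lemma measurable_optimal d (X : set 'cV[R]_d) :
  measurable [set q : 'cV[R]_d * 'cV[R]_d |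
    forall y, X y -> dot q.1 q.2 <= dot q.1 y].
Proof.
pose F := \bigcap_(y in X) [set M : 'M[R]_(d, 1 + 1) |
  0 <= dot (lsubmx M) y - dot (lsubmx M) (rsubmx M)].
have cF : closed F.
  apply: closed_bigI => y _; apply: closed_mx_ge => M.
  have cl i : continuous (fun M : 'M[R]_(d, 1 + 1) => lsubmx M i 0).
    by under eq_fun do rewrite mxE; exact: coord_continuous.
  have cr i : continuous (fun M : 'M[R]_(d, 1 + 1) => rsubmx M i 0).
    by under eq_fun do rewrite mxE; exact: coord_continuous.
  have cy i : continuous (fun M : 'M[R]_(d, 1 + 1) => (y : 'cV[R]_d) i 0).
    exact: cst_continuous.
  exact: (continuousB
    (@dot_continuous_coord d _ (fun M => lsubmx M) (fun=> y) cl cy M)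
    (@dot_continuous_coord d _ (fun M => lsubmx M) (fun M => rsubmx M) cl cr M)).
rewrite [X in measurable X](_ : _ = [set: _] `&`
    (fun q => row_mx q.1 q.2) @^-1` F).
  by apply: measurable_row_mx => //; exact: closed_measurable_mx.
rewrite setTI; apply/seteqP; split => -[c x] /= h y Xy;
  by have := h y Xy; rewrite /= row_mxKl row_mxKr subr_ge0.
Qed.

(** A linear form that vanishes on the range of [U] and not at [v] bounds from
    below the distance between [v] and the range. The right-hand side is a
    countable union of closed conditions on [(v, U)]. *)
Lemma notin_range_dist d r (U : 'M[R]_(d, r)) (v : 'cV[R]_d) :
  ~ range (mulmx U) v <->
  exists k : nat, forall z : 'cV[R]_r, k.+1%:R^-1 <= \sum_i `|(v - U *m z) i 0|.
Proof.
split=> [vU|[k vk] [z _ Uz]]; last first.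
  have := vk z; rewrite Uz subrr big1 ?leNgt ?invr_gt0 ?ltr0n// => i _.
  by rewrite mxE normr0.
have nz : v^T *m cokermx U^T <> 0.
  apply/eqP; rewrite -submxE; apply/negP => /submxP[D vD]; apply: vU.
  by exists D^T => //; rewrite -[U]trmxK -trmx_mul -vD trmxK.
have [j avn0] : exists j, (v^T *m cokermx U^T) 0 j != 0.
  apply/not_existsP => z; apply: nz; apply/rowP => j; rewrite [RHS]mxE.
  by apply/eqP/negP => /negP/z.
(* A column of the cokernel of [U^T] is a linear form vanishing on the range. *)
pose a := (col j (cokermx U^T))^T.
have aE (w : 'cV[R]_d) : (a *m w) 0 0 = (w^T *m cokermx U^T) 0 j.
  by rewrite /a mxE [RHS]mxE; apply: eq_bigr => k _; rewrite !mxE mulrC.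
have aU (z : 'cV[R]_r) : (a *m (U *m z)) 0 0 = 0.
  by rewrite aE trmx_mul -mulmxA mulmx_coker mulmx0 mxE.
pose s := \sum_k `|a 0 k|.
have le_s (w : 'cV[R]_d) : `|(a *m w) 0 0| <= s * \sum_i `|w i 0|.
  rewrite mxE mulr_sumr; apply: le_trans (ler_norm_sum _ _ _) _.
  apply: ler_sum => k _; rewrite normrM ler_wpM2r//.
  by rewrite /s (bigD1 k)//= lerDl sumr_ge0.
have s0 : 0 < s.
  rewrite lt_neqAle sumr_ge0// andbT; apply: contra_neq avn0 => s0.
  by have := le_s v; rewrite -s0 mul0r normr_le0 aE => /eqP ->.
have [k] : exists k : nat, 0 + k.+1%:R^-1 < `|(a *m v) 0 0| / s.
  by apply: ltr_add_invr; rewrite divr_gt0// normr_gt0 aE.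
rewrite add0r => ks; exists k => z; apply: (le_trans (ltW ks)).
rewrite ler_pdivrMr// mulrC; apply: le_trans (le_s _).
by rewrite mulmxBr [in leRHS]mxE [X in _ + X]mxE aU subr0.
Qed.

Lemma measurable_notin_range d r :
  measurable [set q : 'cV[R]_d * 'M[R]_(d, r) | ~ range (mulmx q.2) q.1].
Proof.
pose F k := \bigcap_(z in [set: 'cV[R]_r]) [set M : 'M[R]_(d, 1 + r) |
  k.+1%:R^-1 <= \sum_i `|(lsubmx M - rsubmx M *m z) i 0|].
have cF k : closed (F k).
  apply: closed_bigI => z _; apply: closed_mx_ge.
  apply: continuous_sum_mx => i M.
  have cl j : continuous (fun M : 'M[R]_(d, 1 + r) => M i (lshift r j)).
    exact: coord_continuous.
  have cr : continuous (fun M : 'M[R]_(d, 1 + r) =>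
      \sum_j M i (rshift 1 j) * z j 0).
    apply: continuous_sum_mx => j N.
    have cN := @coord_continuous R d (1 + r) i (rshift 1 j) N.
    exact: (continuousM cN (@cst_continuous _ _ (z j 0) N)).
  rewrite (_ : (fun _ => _) = Num.norm \o ((fun M : 'M[R]_(d, 1 + r) =>
      M i (lshift r 0)) - (fun M => \sum_j M i (rshift 1 j) * z j 0))).
    apply: continuous_comp; last exact: norm_continuous.
    exact: (continuousB (cl 0 M) (cr M)).
  apply/funext => N; rewrite !mxE /= !fctE; congr (`|_ - _|).
  by apply: eq_bigr => j _; rewrite mxE.
rewrite [X in measurable X](_ : _ = [set: _] `&`
    (fun q => row_mx q.1 q.2) @^-1` (\bigcup_k F k)); last first.
  rewrite setTI; apply/seteqP; split => -[v U] /=.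
    move=> /notin_range_dist[k vk]; exists k => // z _ /=.
    by rewrite row_mxKl row_mxKr.
  move=> [k _ vk]; apply/notin_range_dist; exists k => z.
  by have := vk z I; rewrite /= row_mxKl row_mxKr.
apply: measurable_row_mx => //; apply: bigcupT_measurable => k; exact: closed_measurable_mx.
Qed.

End borel_matrices.

(** * Linear programs and exactness *)

Section compactness.
Context {R : realType}.

Lemma norm_trmx m n (M : 'M[R]_(m, n)) : `|M^T| <= `|M|.
Proof.
rewrite [leLHS]/Num.norm /= mx_normrE; apply/bigmax_leP; split => // -[i j] _ /=.
rewrite mxE [leRHS]/Num.norm /= mx_normrE.
by apply/bigmax_geP; right; exists (j, i).
Qed.

Lemma dot_continuous d (c : 'cV[R]_d) :
  continuous (fun v : 'rV[R]_d => dot c v^T).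
Proof.
under eq_fun do rewrite dotE.
apply: continuous_sum_mx => i M.
have cM : continuous (fun v : 'rV[R]_d => v^T i 0).
  by under eq_fun do rewrite mxE; exact: coord_continuous.
exact: (continuousM (@cst_continuous _ _ (c i 0) M) (cM M)).
Qed.

Lemma polyhedronE d p (A : 'M[R]_(p, d)) (b : 'cV[R]_p) x :
  polyhedron A b x <-> forall i, dot (row i A)^T x <= b i 0.
Proof.
have dotA i : dot (row i A)^T x = (A *m x) i 0.
  by rewrite /dot trmxK -row_mul mxE.
by split=> Ax i; have := Ax i; rewrite dotA.
Qed.

Lemma measurable_polyhedron d p (A : 'M[R]_(p, d)) (b : 'cV[R]_p) :
  measurable (polyhedron A b).
Proof.
rewrite (_ : polyhedron A b = \bigcap_(i in [set: 'I_p])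
    [set x | dot (row i A)^T x <= b i 0]).
  apply: fin_bigcap_measurable => // i _.
  apply: (@measurable_set_of _ _ (fun x => dot (row i A)^T x <= b i 0)).
  apply: measurable_fun_ler => //.
  rewrite (_ : dot _ = fun x => \sum_k (row i A)^T k 0 * x k 0); last first.
    by apply/funext => x; rewrite dotE.
  apply: measurable_sum => k; apply: measurable_funM => //.
  exact: measurable_coord.
apply/seteqP; split=> [x /polyhedronE Ax i _|x Ax]; first exact: Ax.
by apply/polyhedronE => i; exact: Ax.
Qed.

(** The extreme value theorem, transported from row vectors to columns. *)
Lemma Xstar_nonempty d p (A : 'M[R]_(p, d)) (b : 'cV[R]_p) (c : 'cV[R]_d) :
  polyhedron A b !=set0 -> bounded_set (polyhedron A b) ->
  Xstar (polyhedron A b) c !=set0.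
Proof.
move=> [x Xx] Xb; pose X' := [set v : 'rV[R]_d | polyhedron A b v^T].
have X'b : bounded_set X'.
  case: Xb => M [Mr XM]; exists M; split => // M' MM' v /= Xv.
  by apply: le_trans (XM _ MM' _ Xv); rewrite -[v in leLHS]trmxK norm_trmx.
have X'c : closed X'.
  rewrite (_ : X' = \bigcap_(i in [set: 'I_p])
      [set v : 'rV[R]_d | - b i 0 <= - dot (row i A)^T v^T]).
    apply: closed_bigI => i _; apply: closed_mx_ge => M.
    exact: (continuousN (@dot_continuous d (row i A)^T M)).
  apply/seteqP; split=> [v /polyhedronE Xv i _|v Xv].
    by rewrite /= lerN2; exact: Xv.
  by apply/polyhedronE => i; have := Xv i I; rewrite /= lerN2.
have X'0 : X' !=set0 by exists x^T; rewrite /X' /= trmxK.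
have [|v] := @EVT_min_rV R d (fun v => dot c v^T) X' X'0
    (bounded_closed_compact X'b X'c).
  by apply: continuous_subspaceT; exact: dot_continuous.
rewrite inE => Xv vmin; exists v^T; split => // y Xy.
by have := vmin y^T; rewrite inE /X' /= trmxK; exact.
Qed.

End compactness.

Section exactness.
Context {R : realType} {d : nat}.

Lemma dotDr (c x y : 'cV[R]_d) : dot c (x + y) = dot c x + dot c y.
Proof. by rewrite /dot mulmxDr mxE. Qed.

Lemma dot_mulmx r (U : 'M[R]_(d, r)) (c : 'cV[R]_d) z :
  dot (U^T *m c) z = dot c (U *m z).
Proof. by rewrite /dot trmx_mul trmxK mulmxA. Qed.

Lemma range_affine_map r (U : 'M[R]_(d, r)) (x0 x : 'cV[R]_d) :
  range (affine_map U x0) x <-> range (mulmx U) (x - x0).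
Proof.
split=> -[z _ zx]; exists z => //; first by rewrite -zx /affine_map addrC addKr.
by rewrite /affine_map zx addrC subrK.
Qed.

(** As soon as one optimal solution lies in the slice, the restricted program
    has the same value, and its solutions are the optimal ones in the slice. *)
Lemma ExactP (X : set 'cV[R]_d) r (U : 'M[R]_(d, r)) (x0 c : 'cV[R]_d) :
  Xstar X c !=set0 ->
  Exact X U x0 c <-> Xstar X c `<=` range (affine_map U x0).
Proof.
move=> [xm xmX]; split => [->|XU]; first by move=> _ [z _ <-]; exists z.
have dotT z : dot c (affine_map U x0 z) = dot c x0 + dot (U^T *m c) z.
  by rewrite dotDr dot_mulmx.
apply/seteqP; split => [x xX|_ [z [Xz zmin] <-]].
  have [z _ zx] := XU _ xX; exists z => //; split; first by rewrite /Zset /= zx; case: xX.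
  move=> y Xy; have := xX.2 _ Xy.
  by rewrite -zx !dotT lerD2l.
split=> // y Xy; have [zm _ zxm] := XU _ xmX.
apply: (@le_trans _ _ (dot c xm)); last exact: xmX.2.
by rewrite -zxm !dotT lerD2l; apply: zmin; rewrite /Zset /= zxm; exact: xmX.1.
Qed.

(** For a feasible anchor this says that some optimal solution lies outside the
    slice ([hardP]). The choice of the tie-breaking rule serves as a measurable
    witness: with an existential quantifier instead, the set of hard costs would
    be a projection, whose measurability is a harder question. *)
Definition hard (X : set 'cV[R]_d) (pick : @rule R d) (x0 c : 'cV[R]_d) r
    (U : 'M[R]_(d, r)) : Prop :=
  Xstar X c (pick x0 c r U) /\ ~ range (mulmx U) (pick x0 c r U - x0).

Lemma hardP (X : set 'cV[R]_d) (pick : @rule R d) (x0 c : 'cV[R]_d) r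
    (U : 'M[R]_(d, r)) : tie_breaking X pick -> X x0 ->
  hard X pick x0 c U <-> ~ (Xstar X c `<=` range (affine_map U x0)).
Proof.
move=> [_ tb] Xx0; split=> [[Xp pU] XU|/(tb x0 c r U Xx0)[]//].
by apply: pU; apply/range_affine_map; exact: XU.
Qed.

(** The source of the monotonicity of the error along a run. *)
Lemma hard_mono (X : set 'cV[R]_d) (pick : @rule R d) (x0 c : 'cV[R]_d) r
    (U : 'M[R]_(d, r)) r' (U' : 'M[R]_(d, r')) : tie_breaking X pick -> X x0 ->
  (forall v : 'cV[R]_d, range (mulmx U) v -> range (mulmx U') v) ->
  hard X pick x0 c U' -> hard X pick x0 c U.
Proof.
move=> tb Xx0 UU' /hardP => /(_ tb Xx0) nU'; apply/hardP => // XU; apply: nU'.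
by move=> x /XU /range_affine_map /UU' /range_affine_map.
Qed.

Lemma measurable_hard p (A : 'M[R]_(p, d)) (b : 'cV[R]_p) (pick : @rule R d) r :
  tie_breaking (polyhedron A b) pick ->
  measurable [set q : 'cV[R]_d * 'cV[R]_d * 'M[R]_(d, r) |
    hard (polyhedron A b) pick q.1.1 q.1.2 q.2].
Proof.
move=> [mp _].
have mpick := mp r.
pose X := polyhedron A b.
have mc : measurable_fun [set: 'cV[R]_d * 'cV[R]_d * 'M[R]_(d, r)] (fun q => q.1.2).
  exact: (measurableT_comp measurable_snd measurable_fst).
have mx0 : measurable_fun [set: 'cV[R]_d * 'cV[R]_d * 'M[R]_(d, r)] (fun q => q.1.1).
  exact: (measurableT_comp measurable_fst measurable_fst).
have mX : measurable X by exact: measurable_polyhedron.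
have m1 := measurable_fun_pair mc mpick.
rewrite [Y in measurable Y](_ : _ =
  ((fun q => pick q.1.1 q.1.2 r q.2) @^-1` X
  `&` (fun q => (q.1.2, pick q.1.1 q.1.2 r q.2)) @^-1`
     [set q : 'cV[R]_d * 'cV[R]_d |
    forall y, X y -> dot q.1 q.2 <= dot q.1 y])
  `&` (fun q => (pick q.1.1 q.1.2 r q.2 - q.1.1, q.2)) @^-1`
    [set q : 'cV[R]_d * 'M[R]_(d, r) | ~ range (mulmx q.2) q.1]); last first.
  by [].
apply: measurableI; first apply: measurableI.
- by rewrite -[Y in measurable Y]setTI; exact: mpick.
- by rewrite -[Y in measurable Y]setTI; apply: m1 => //; exact: measurable_optimal.
- rewrite -[Y in measurable Y]setTI.
  apply: (measurable_fun_pair _ measurable_snd) => //; last exact: measurable_notin_range.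
  apply: measurable_fun_mx => i j.
  under eq_fun do rewrite !mxE.
  apply: measurable_funB.
    exact: (measurableT_comp (measurable_coord i j) mpick).
  exact: (measurableT_comp (measurable_coord i j) mx0).
Qed.
End exactness.

(** * The learning loop as an iteration *)

Section loops.
Context {R : realType} {d : nat} (X : set 'cV[R]_d) (pick : @rule R d).

(** A matrix with [r] columns is kept as the first [r] columns of a matrix of
    fixed size, so that all states of a run live in one measurable space. The
    extra column absorbs a step taken from [r = d]. *)
Definition columns : Type := ('M[R]_(d, d.+1) * nat)%type.

Definition cols r (M : 'M[R]_(d, d.+1)) : 'M[R]_(d, r) :=
  \matrix_(i, j) M i (inord j).

Definition used_cols (s : columns) : 'M[R]_(d, s.2) := cols s.2 s.1.

Definition setcol r (v : 'cV[R]_d) (M : 'M[R]_(d, d.+1)) : 'M[R]_(d, d.+1) :=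
  \matrix_(i, j) if (j : nat) == r then v i 0 else M i j.

Lemma cols_setcol r v M : (r <= d)%N ->
  cols (r + 1) (setcol r v M) = row_mx (cols r M) v.
Proof.
move=> rd; apply/matrixP => i j; case: (split_ordP j) => k ->.
  rewrite row_mxEl !mxE /= inordK; last by rewrite ltnS (leq_trans _ rd)// ltnW.
  by rewrite ltn_eqF.
by rewrite row_mxEr !mxE /= (ord1 k) addn0 inordK// eqxx.
Qed.

(** The body of the while loop, stopped where a new column could no longer be
    stored. A state with independent columns never gets there. *)
Definition pick_step (x0 c : 'cV[R]_d) (s : columns) : columns :=
  if `[<hard X pick x0 c (used_cols s)>] && (s.2 <= d)%N
  then (setcol s.2 (pick x0 c (used_cols s) - x0) s.1, (s.2 + 1)%N) else s.

Definition pick_loop (x0 c : 'cV[R]_d) : columns -> columns :=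
  iter d.+1 (pick_step x0 c).

Definition colspan (s : columns) : set 'cV[R]_d := range (mulmx (used_cols s)).

Lemma range_row_mx r (U : 'M[R]_(d, r)) (w v : 'cV[R]_d) :
  range (mulmx (row_mx U w)) v <->
  exists a, range (mulmx U) (v - a *: w).
Proof.
split=> [[z _ <-]|[a [z _ zv]]].
  exists (dsubmx z 0 0), (usubmx z) => //.
  have {2}-> : z = col_mx (usubmx z) (dsubmx z 0 0)%:M.
    by rewrite -mx11_scalar vsubmxK.
  by rewrite mul_row_col mul_mx_scalar addrK.
exists (col_mx z a%:M) => //.
by rewrite mul_row_col zv mul_mx_scalar subrK.
Qed.

Lemma colspan_pick_step x0 c s : colspan s `<=` colspan (pick_step x0 c s).
Proof.
rewrite /pick_step; case: ifPn => [hd|_]; last by [].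
have rd : (s.2 <= d)%N by case/andP: hd.
move=> v vs.
rewrite /colspan /used_cols /= cols_setcol//; apply/range_row_mx.
by exists 0; rewrite scale0r subr0.
Qed.

Lemma size_pick_step x0 c s : (s.2 <= (pick_step x0 c s).2)%N.
Proof. by rewrite /pick_step; case: ifP => //= _; rewrite leq_addr. Qed.

Lemma colspan_iter k x0 c s :
  colspan s `<=` colspan (iter k (pick_step x0 c) s).
Proof. by elim: k => //= k IHk v /IHk; exact: colspan_pick_step. Qed.

Lemma size_iter k x0 c s : (s.2 <= (iter k (pick_step x0 c) s).2)%N.
Proof.
by elim: k => //= k IHk; apply: leq_trans IHk (size_pick_step _ _ _).
Qed.

Lemma pick_loop_hard x0 c s : hard X pick x0 c (used_cols s) -> (s.2 <= d)%N ->
  (s.2 < (pick_loop x0 c s).2)%N.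
Proof.
move=> hs sd; rewrite /pick_loop iterSr.
have -> : pick_step x0 c s = (setcol s.2 (pick x0 c (used_cols s) - x0) s.1, (s.2 + 1)%N).
  by rewrite /pick_step sd andbT; case: asboolP.
by apply: leq_trans (size_iter _ _ _ _); rewrite /= addn1.
Qed.

Lemma iter_easy k x0 c s : ~ hard X pick x0 c (used_cols s) ->
  iter k (pick_step x0 c) s = s.
Proof.
by move=> hs; elim: k => //= k ->; rewrite /pick_step; case: asboolP.
Qed.

(** One inclusion of spans is enough: a choice outside the column span is then
    outside the span of [L], so [L] stays free when it is added. *)
Definition independent_cols (V : {vspace 'cV[R]_d}) (s : columns) : Prop :=
  exists L : seq 'cV[R]_d, [/\ size L = s.2, free L, {subset L <= V} &
    forall v, v \in <<L>>%VS -> colspan s v].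

Lemma independent_cols_le V s : independent_cols V s ->
  (s.2 <= \dim V)%N /\ (s.2 <= d)%N.
Proof.
move=> [L [<- fL LV _]].
have LVd : (size L <= \dim V)%N.
  move: fL; rewrite /free => /eqP <-; apply: dimvS; exact/span_subvP.
split=> //; apply: leq_trans LVd _; apply: leq_trans (dimvS (subvf V)) _.
by rewrite dimvf /dim /= muln1.
Qed.

(** A choice outside the current range keeps the list of columns free. As no
    [d + 1] vectors are free, [k] steps from [r] columns with [k + r > d] must
    reach the end of the loop. *)
Lemma while_loop_iter (V : {vspace 'cV[R]_d}) x0 c k s : tie_breaking X pick -> X x0 ->
  (forall x, Xstar X c x -> x - x0 \in V) ->
  independent_cols V s -> (d < k + s.2)%N ->
  let s' := iter k (pick_step x0 c) s in
  while_loop X pick x0 c (used_cols s) (used_cols s') /\ independent_cols V s'.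
Proof.
move=> tb Xx0 cV; elim: k s => [|k IHk] s si dk.
  by have [_] := independent_cols_le si; rewrite leqNgt dk.
rewrite iterSr.
have [_ sd] := independent_cols_le si.
have [hs|hs] := pselect (hard X pick x0 c (used_cols s)); last first.
  rewrite -iterSr iter_easy//.
  by split=> //; apply: while_stop; apply: contrapT => nc; apply: hs; apply/hardP.
have ws : pick_step x0 c s = (setcol s.2 (pick x0 c (used_cols s) - x0) s.1, (s.2 + 1)%N).
  by rewrite /pick_step sd andbT; case: asboolP.
rewrite ws; set w := pick x0 c (used_cols s) - x0.
pose s1 : columns := (setcol s.2 w s.1, (s.2 + 1)%N).
have s1E : used_cols s1 = row_mx (used_cols s) w by exact: cols_setcol.
have si' : independent_cols V s1.
  case: si => L [Ls fL LV Lspan]; exists (w :: L); split.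
  - by rewrite /= Ls addn1.
  - rewrite free_cons fL andbT; apply/negP => /Lspan.
    by case: hs => _; exact.
  - by move=> v; rewrite inE => /predU1P[->|/LV//]; apply: cV; case: hs.
  - move=> v; rewrite span_cons => /memv_addP[_ /vlineP[a ->] [u uL ->]].
    rewrite /colspan s1E; apply/range_row_mx; exists a.
    by rewrite addrAC subrr add0r; exact: Lspan.
have [wl si''] := IHk _ si' ltac:(by rewrite /= addn1 addnS -addSn).
split=> //; apply: while_step; first by apply/(hardP _ _ tb Xx0).
by rewrite -s1E.
Qed.

End loops.

(** * Measurability of a run *)

Lemma measurable_asbool {dT} {T : measurableType dT} (P : T -> Prop) :
  measurable [set t | P t] -> measurable_fun [set: T] (fun t => `[<P t>]).
Proof.
move=> mP; apply: (measurable_fun_bool true); rewrite setTI.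
rewrite [Y in measurable Y](_ : _ = [set t | P t])//.
by apply/seteqP; split => t /= /asboolP.
Qed.

Section measurable_run.
Context {R : realType} {d p : nat} (A : 'M[R]_(p, d)) (b : 'cV[R]_p).
Context (pick : @rule R d) (tb : tie_breaking (polyhedron A b) pick).

Let X := polyhedron A b.

Lemma measurable_cols r :
  measurable_fun [set: 'M[R]_(d, d.+1)] (fun M => cols r M).
Proof.
apply: measurable_fun_mx => i j; under eq_fun do rewrite mxE.
exact: measurable_coord.
Qed.

Lemma measurable_setcol {dT} {T : measurableType dT} r
    (v : T -> 'cV[R]_d) (M : T -> 'M[R]_(d, d.+1)) :
  measurable_fun [set: T] v -> measurable_fun [set: T] M ->
  measurable_fun [set: T] (fun t => setcol r (v t) (M t)).
Proof.
move=> mv mM; apply: measurable_fun_mx => i j; under eq_fun do rewrite mxE.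
by case: (nat_of_ord j == r); exact: (measurableT_comp (measurable_coord _ _)).
Qed.

Lemma measurable_hard_cols r :
  measurable [set q : 'cV[R]_d * 'cV[R]_d * 'M[R]_(d, d.+1) |
    hard X pick q.1.1 q.1.2 (cols r q.2)].
Proof.
have mq := measurable_fun_pair
  (@measurable_fst _ _ ('cV[R]_d * 'cV[R]_d)%type 'M[R]_(d, d.+1))
  (measurableT_comp (@measurable_cols r) measurable_snd).
by have := mq measurableT _ (measurable_hard (r:=r) tb); rewrite setTI.
Qed.

Lemma measurable_pick_step :
  measurable_fun [set: 'cV[R]_d * 'cV[R]_d * ('M[R]_(d, d.+1) * nat)]
    (fun q => pick_step X pick q.1.1 q.1.2 q.2).
Proof.
pose T := ('cV[R]_d * 'cV[R]_d * ('M[R]_(d, d.+1) * nat))%type.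
pose f r (q : T) : 'M[R]_(d, d.+1) * nat :=
  if `[<hard X pick q.1.1 q.1.2 (cols r q.2.1)>] && (r <= d)%N
  then (setcol r (pick q.1.1 q.1.2 (cols r q.2.1) - q.1.1) q.2.1, (r + 1)%N)
  else (q.2.1, r).
rewrite (_ : (fun q => _) = fun q => f q.2.2 q); last first.
  by apply/funext => -[[x0 c] [M r]].
have mM : measurable_fun [set: T] (fun q => q.2.1).
  exact: (measurableT_comp measurable_fst measurable_snd).
have mx0 : measurable_fun [set: T] (fun q => q.1.1).
  exact: (measurableT_comp measurable_fst measurable_fst).
apply: measurable_fun_nat_case.
  exact: (measurableT_comp measurable_snd measurable_snd).
move=> r.
have mc : measurable_fun [set: T] (fun q => (q.1, cols r q.2.1)).
  apply: measurable_fun_pair => //.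
  exact: (measurableT_comp (@measurable_cols r)).
apply: measurable_fun_ifT.
- apply: measurable_and => //; apply: measurable_asbool.
  by have := mc measurableT _ (measurable_hard (r:=r) tb); rewrite setTI.
- apply: measurable_fun_pair => //; apply: measurable_setcol => //.
  apply: measurable_fun_mx => i j; under eq_fun do rewrite !mxE.
  apply: measurable_funB; last exact: (measurableT_comp (measurable_coord i j)).
  apply: (measurableT_comp (measurable_coord i j)).
  exact: (measurableT_comp (tb.1 r) mc).
- exact: measurable_fun_pair.
Qed.

Lemma measurable_iter_pick_step k :
  measurable_fun [set: 'cV[R]_d * 'cV[R]_d * ('M[R]_(d, d.+1) * nat)]
    (fun q => iter k (pick_step X pick q.1.1 q.1.2) q.2).
Proof.
elim: k => [|k IHk]; first exact: measurable_snd.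
have mp := measurable_fun_pair measurable_fst IHk.
exact: (measurableT_comp measurable_pick_step mp).
Qed.

Section stream.
Context {dW : measure_display} {Wt : measurableType dW}.
Context (C : Wt -> set 'cV[R]_d) (n1 : nat).
Hypothesis mC : measurable [set q : Wt * 'cV[R]_d | C q.1 q.2].

(** The pilot and the anchor, the columns, and the number of retained samples;
    nested pairs carry the product sigma-algebra. *)
Definition run_state : Type :=
  (Wt * 'cV[R]_d * ('M[R]_(d, d.+1) * nat) * nat)%type.

Definition run_step (q : run_state * 'cV[R]_d) : run_state :=
  if (q.1.2 < n1)%N && `[<C q.1.1.1.1 q.2>]
  then (q.1.1.1, pick_loop X pick q.1.1.1.2 q.2 q.1.1.2, (q.1.2 + 1)%N) else q.1.

Lemma measurable_run_step : measurable_fun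
  [set: Wt * 'cV[R]_d * ('M[R]_(d, d.+1) * nat) * nat * 'cV[R]_d] run_step.
Proof.
pose T := (Wt * 'cV[R]_d * ('M[R]_(d, d.+1) * nat) * nat * 'cV[R]_d)%type.
have m1 : measurable_fun [set: T] (fun q => q.1) by exact: measurable_fst.
have m11 : measurable_fun [set: T] (fun q => q.1.1).
  exact: (measurableT_comp measurable_fst m1).
have m12 : measurable_fun [set: T] (fun q => q.1.2).
  exact: (measurableT_comp measurable_snd m1).
have m111 : measurable_fun [set: T] (fun q => q.1.1.1).
  exact: (measurableT_comp measurable_fst m11).
have m112 : measurable_fun [set: T] (fun q => q.1.1.2).
  exact: (measurableT_comp measurable_snd m11).
have m1111 : measurable_fun [set: T] (fun q => q.1.1.1.1).
  exact: (measurableT_comp measurable_fst m111).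
have m1112 : measurable_fun [set: T] (fun q => q.1.1.1.2).
  exact: (measurableT_comp measurable_snd m111).
have m2 : measurable_fun [set: T] (fun q => q.2) by exact: measurable_snd.
apply: measurable_fun_ifT.
- apply: measurable_and; first exact: measurable_fun_ltn.
  apply: measurable_asbool.
  by have := measurable_fun_pair m1111 m2 measurableT mC; rewrite setTI.
- apply: measurable_fun_pair; first apply: measurable_fun_pair => //.
    have mp := measurable_fun_pair (measurable_fun_pair m1112 m2) m112.
    exact: (measurableT_comp (@measurable_iter_pick_step d.+1) mp).
  exact: (measurableT_comp (_ : measurable_fun _ (fun n => (n + 1)%N)) m12).
- exact: m1.
Qed.

End stream.
End measurable_run.

(** * Fresh samples *)

Section fresh.
Context {R : realType} {dO : measure_display} {Omega : measurableType dO}.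
Context (P : probability Omega R) {dT : measure_display} {T : measurableType dT}.
Context (mu : probability T R) {I : eqType} (X : I -> {RV P >-> T}).

Definition rectangle (l : seq I) (D : I -> set T) : set Omega :=
  \big[setI/setT]_(i <- l) (X i @^-1` D i).

(** The samples listed in [l] are independent of [s] and i.i.d. of law [mu].
    Testing rectangles only, the definition makes sense for lists of every
    length, and a walk preserves it while it consumes the list. *)
Definition fresh {dS} {S : measurableType dS} (s : Omega -> S) (l : seq I) :
    Prop :=
  measurable_fun [set: Omega] s /\
  forall A (D : I -> set T), measurable A -> (forall i, measurable (D i)) ->
    (P (s @^-1` A `&` rectangle l D) =
      P (s @^-1` A) * (\prod_(i <- l) fine (mu (D i)))%:E)%E.

Lemma measurable_rectangle l D : (forall i, measurable (D i)) ->
  measurable (rectangle l D).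
Proof.
move=> mD; apply: bigsetI_measurable => i _.
by rewrite -[Y in measurable Y]setTI; exact: measurable_funPT.
Qed.

Lemma fresh_comp {dS} {S : measurableType dS} {dS'} {S' : measurableType dS'}
    (s : Omega -> S) (f : S -> S') l :
  measurable_fun [set: S] f -> fresh s l -> fresh (f \o s) l.
Proof.
move=> mf [ms sl]; split=> [|A D mA mD]; first exact: measurableT_comp.
rewrite comp_preimage sl//; rewrite -[Y in measurable Y]setTI; exact: mf.
Qed.

Lemma fresh_cons_rect {dS} {S : measurableType dS} (s : Omega -> S) i (l : seq I) A B D :
  i \notin l -> fresh s (i :: l) -> measurable A -> measurable B ->
  (forall j, measurable (D j)) ->
  (P (s @^-1` A `&` (X i @^-1` B) `&` rectangle l D) =
   P (s @^-1` A) * mu B * (\prod_(j <- l) fine (mu (D j)))%:E)%E.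
Proof.
move=> il [_ sl] mA mB mD.
pose D' j := if j == i then B else D j.
have mD' j : measurable (D' j) by rewrite /D'; case: ifP.
have eD (j : I) : j \in l -> D' j = D j.
  by rewrite /D'; case: eqP => // -> jl; rewrite jl in il.
have D'i : D' i = B by rewrite /D' eqxx.
have := sl A D' mA mD'; rewrite /rectangle !big_cons D'i.
rewrite (eq_big_seq (fun j => X j @^-1` D j)) => [|j /eD ->//].
rewrite (eq_big_seq (fun j => fine (mu (D j)))) => [|j /eD ->//].
rewrite setIA => ->; rewrite EFinM muleA fineK//.
exact: fin_num_measure.
Qed.

Lemma fresh_indep {dS} {S : measurableType dS} (s : Omega -> S) i (l : seq I) A B :
  i \notin l -> fresh s (i :: l) -> measurable A -> measurable B ->
  (P (s @^-1` A `&` (X i @^-1` B)) = P (s @^-1` A) * mu B)%E.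
Proof.
move=> il sl mA mB.
have := fresh_cons_rect il sl mA mB (fun=> measurableT).
have -> : rectangle l (fun=> setT) = setT.
  rewrite /rectangle; elim: (l) => [|j l' IHl]; first by rewrite big_nil.
  by rewrite big_cons IHl preimage_setT setTI.
rewrite big1 ?setIT ?mule1// => j _.
by rewrite probability_setT.
Qed.

(** The sets [Q] that satisfy the product formula form a Dynkin system. For a
    rectangle [A x B] the formula holds because the head of the list contributes
    one more factor to a rectangle of samples. *)
Lemma fresh_step {dS} {S : measurableType dS} (s : Omega -> S) i l :
  i \notin l -> fresh s (i :: l) -> fresh (fun w => (s w, X i w)) l.
Proof.
move=> il sl; have [ms _] := sl.
have msX : measurable_fun [set: Omega] (fun w => (s w, X i w)).
  by apply: measurable_fun_pair => //; exact: measurable_funPT.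
split=> // Q D mQ mD; set K := (\prod_(j <- l) _)%:E.
have mR := measurable_rectangle l mD; set U := rectangle l D in mR *.
set f := fun w => (s w, X i w).
have mf Q' : measurable Q' -> measurable (f @^-1` Q').
  by move=> mQ'; rewrite -[Y in measurable Y]setTI; exact: msX.
pose G : set (set (S * T)) := [set A `*` B | A in measurable & B in measurable].
have PU : P U = K.
  have := fresh_cons_rect il sl measurableT measurableT mD.
  by rewrite !preimage_setT !setTI !probability_setT !mul1e.
apply: (@dynkin_induction _ _ G
  (fun Q => P (f @^-1` Q `&` U) = P (f @^-1` Q) * K)%E).
- by rewrite measurable_prod_measurableType.
- move=> _ _ [A1 mA1 [B1 mB1 <-]] [A2 mA2 [B2 mB2 <-]].
  rewrite -setXI; exists (A1 `&` A2); first exact: measurableI.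
  by exists (B1 `&` B2) => //; exact: measurableI.
- by rewrite preimage_setT setTI probability_setT mul1e.
- move=> _ [A mA [B mB <-]].
  by rewrite [f @^-1` _](_ : _ = s @^-1` A `&` (X i @^-1` B))//
    (fresh_cons_rect il sl)// (fresh_indep il sl).
- move=> Q' mQ' PQ'.
  have -> : f @^-1` (~` Q') `&` U = U `\` (f @^-1` Q' `&` U).
    apply/seteqP; split => w /=; first by move=> [nQ Uw]; split=> // -[].
    by move=> [Uw nQU]; split => // Qw; apply: nQU.
  rewrite measureD//; last 2 first.
    by apply: measurableI => //; exact: mf.
    by rewrite ltey_eq fin_num_measure.
  rewrite setICA setIid preimage_setC.
  transitivity (K - P (f @^-1` Q') * K)%E; first by congr (_ - _)%E.
  rewrite probability_setC; last exact: mf.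
  by rewrite muleBl// ?mul1e//= fin_num_measure//; exact: mf.
- move=> F mF tF PF.
  rewrite preimage_bigcup setI_bigcupl measure_bigcup//; last 2 first.
    by move=> n _; apply: measurableI => //; exact: mf.
    move=> m n _ _ [w [[Fm _] [Fn _]]]; apply: (tF m n) => //.
    by exists (f w).
  rewrite measure_bigcup//; last 2 first.
    by move=> n _; exact: mf.
    by move=> m n _ _ [w [Fm Fn]]; apply: (tF m n) => //; exists (f w).
  rewrite [RHS]muleC -nneseriesZl//.
  by apply: eq_eseriesr => n _; rewrite muleC; exact: PF.
- by rewrite -measurable_prod_measurableType.
Qed.

(** [s] and [X i] have a product law, hence the sample is integrated out first. *)
Lemma fresh_integral {dS} {S : measurableType dS} (s : Omega -> S) i (l : seq I)
    (f : S * T -> \bar R) :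
  i \notin l -> fresh s (i :: l) ->
  measurable_fun [set: S * T] f -> (forall q, 0 <= f q)%E ->
  (\int[P]_w f (s w, X i w) = \int[P]_w \int[mu]_x f (s w, x))%E.
Proof.
move=> il sl mf f0; have [ms _] := sl.
have msX : measurable_fun [set: Omega] (fun w => (s w, X i w)).
  by apply: measurable_fun_pair => //; exact: measurable_funPT.
have Fs : measurable_fun [set: S] (fun x => \int[mu]_y f (x, y))%E.
  exact: measurable_fun_fubini_tonelli_F.
pose sm : {mfun Omega >-> S} := HB.pack s (isMeasurableFun.Build _ _ _ _ s ms).
pose sX : {mfun Omega >-> (S * T)%type} :=
  HB.pack (fun w => (s w, X i w)) (isMeasurableFun.Build _ _ _ _ _ msX).
have law : forall Q, measurable Q -> (distribution P sm \x mu)%E Q = distribution P sX Q.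
  apply: product_measure_unique => A B mA mB.
  by have := fresh_indep il sl mA mB.
have := @ge0_integral_pushforward _ _ _ _ R _ msX P setT f measurableT mf.
rewrite preimage_setT => <-//.
have := @ge0_integral_pushforward _ _ _ _ R _ ms P setT _ measurableT Fs.
rewrite preimage_setT /= => <-; last by move=> x _; exact: integral_ge0.
rewrite -(@fubini_tonelli1 _ _ S T R (distribution P sm) mu f mf f0).
by apply: eq_measure_integral => Q mQ _; exact/esym/law.
Qed.

End fresh.

Section fresh_tuple.
Context {R : realType} {dO : measure_display} {Omega : measurableType dO}.
Context (P : probability Omega R) {dT : measure_display} {T : measurableType dT}.
Context (mu : probability T R) {I : eqType} (X : I -> {RV P >-> T}).

Lemma fresh_cst {dS} {S : measurableType dS} (s : S) l :
  iid mu X -> uniq l -> fresh mu X (fun=> s) l.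
Proof.
move=> [mi cd] ul; split=> // B D mB mD.
have Prect : P (rectangle X l D) = (\prod_(i <- l) fine (mu (D i)))%:E.
  rewrite [LHS](mi _ _ ul mD); congr EFin; apply: eq_bigr => i _.
  by rewrite -(cd i).
have [sB|sB] := pselect (B s).
  rewrite (_ : _ @^-1` B = setT); last by apply/seteqP; split.
  by rewrite setTI probability_setT mul1e.
rewrite (_ : _ @^-1` B = set0); last by apply/seteqP; split.
by rewrite set0I measure0 mul0e.
Qed.

(** Built from the last component to the first, one fresh sample at a time. *)
Lemma fresh_tuple n (f : 'I_n -> I) l : iid mu X ->
  uniq ([seq f i | i <- enum 'I_n] ++ l) ->
  fresh mu X (fun w => [tuple X (f i) w | i < n]) l.
Proof.
move=> hX; elim: n f l => [|n IHn] f l ul.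
  rewrite (_ : (fun w => _) = fun=> [tuple of [::]]); last first.
    by apply/funext => w; apply/val_inj/size0nil; rewrite size_tuple.
  apply: fresh_cst => //; by move: ul; rewrite cat_uniq => /and3P[].
have f0 : f ord0 \notin [seq f (lift ord0 i) | i <- enum 'I_n] ++ l.
  by move: ul; rewrite enum_ordSl /= -map_comp => /andP[].
have ul' : uniq ([seq f (lift ord0 i) | i <- enum 'I_n] ++ (f ord0 :: l)).
  rewrite -cat_rcons cat_rcons uniq_catC /= cat_uniq.
  move: ul; rewrite enum_ordSl /= -map_comp cat_uniq => /andP[f0' /and3P[u1 u2 u3]].
  rewrite mem_cat in f0'; rewrite u1 u3 mem_cat orbC f0' /=.
  by rewrite andbT -all_predC; move: u2; rewrite -all_predC => /allP u2;
    apply/allP => x xm /=; apply/negP => xl; have := u2 _ xl; rewrite /= xm.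
have := IHn _ _ ul'.
have f0l : f ord0 \notin l by move: f0; rewrite mem_cat negb_or => /andP[].
move=> /(fresh_step f0l) h.
have := @fresh_comp _ _ _ P _ _ mu _ X _ _ _ _ _
  (fun q : n.-tuple T * T => [the n.+1.-tuple T of q.2 :: q.1]) l _ h.
have mc : measurable_fun [set: n.-tuple T * T]
    (fun q : n.-tuple T * T => [the n.+1.-tuple T of q.2 :: q.1]).
  by apply: measurable_cons.
move=> /(_ mc); congr fresh; apply/funext => w; apply/val_inj => /=.
by rewrite enum_ordSl /= -map_comp.
Qed.

End fresh_tuple.

Section walks.
Context {R : realType} {dO : measure_display} {Omega : measurableType dO}.
Context (P : probability Omega R) {dT : measure_display} {T : measurableType dT}.
Context (mu : probability T R) {I : eqType} (X : I -> {RV P >-> T}).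
Context {dS : measure_display} {S : measurableType dS} (step : S * T -> S).
Hypothesis mstep : measurable_fun [set: S * T] step.

Definition walk (s : Omega -> S) (l : seq I) (w : Omega) : S :=
  foldl (fun x t => step (x, t)) (s w) [seq X i w | i <- l].

Lemma fresh_walk s l l' : uniq (l ++ l') ->
  fresh mu X s (l ++ l') -> fresh mu X (walk s l) l'.
Proof.
elim: l s => [//|i l IHl] s /= /andP[il ul] sl.
rewrite (_ : walk s (i :: l) = walk (step \o (fun w => (s w, X i w))) l)//.
by apply: IHl => //; apply: fresh_comp => //; exact: fresh_step.
Qed.

(** The supermartingale property, with freshness in the place of conditional
    expectations. *)
Lemma integral_walk_le (V : S -> \bar R) (a : R) s l : 0 <= a ->
  measurable_fun [set: S] V -> (forall x, 0 <= V x)%E ->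
  (forall x, \int[mu]_t V (step (x, t)) <= a%:E * V x)%E ->
  uniq l -> fresh mu X s l ->
  (\int[P]_w V (walk s l w) <= (a ^+ size l)%:E * \int[P]_w V (s w))%E.
Proof.
move=> a0 mV V0 drift; elim: l s => [|i l IHl] s.
  by rewrite expr0 mul1e.
rewrite /= => /andP[il ul] sl; have [ms _] := sl.
have si := fresh_comp mstep (fresh_step il sl).
apply: le_trans (IHl _ ul si) _; rewrite exprSr EFinM -muleA.
apply: lee_wpmul2l; first by rewrite lee_fin exprn_ge0.
rewrite /= (fresh_integral (f := V \o step) il sl); last 2 first.
- exact: measurableT_comp.
- by move=> q /=.
have mVs : measurable_fun [set: Omega] (fun w => V (s w)).
  exact: measurableT_comp.
have mF : measurable_fun [set: S] (fun x => \int[mu]_t V (step (x, t)))%E.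
  apply: (@measurable_fun_fubini_tonelli_F _ _ S T R mu (V \o step)).
  - exact: measurableT_comp.
  - by move=> q /=.
apply: (@le_trans _ _ (\int[P]_w (a%:E * V (s w)))%E); last first.
  by rewrite ge0_integralZl_EFin.
apply: ge0_le_integral => //.
- by move=> w _; apply: integral_ge0 => x _; exact: V0.
- exact: (measurableT_comp mF).
- exact: measurable_funeM.
- by move=> w _; exact: drift.
Qed.

End walks.

Section integral_bounds.
Context {R : realType} {d : measure_display} {T : measurableType d}.
Context (mu : probability T R).

Lemma integral_le_cst (E : set T) (f : T -> \bar R) (a : R) :
  measurable E -> measurable_fun [set: T] f -> (forall x, 0 <= f x)%E ->
  (forall x, E x -> f x <= a%:E)%E ->
  (\int[mu]_(x in E) f x <= a%:E * mu E)%E.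
Proof.
move=> mE mf f0 fa; rewrite -integral_cst//; apply: ge0_le_integral => //.
exact: measurable_funTS.
Qed.

Lemma integral_split (E : set T) (f : T -> \bar R) :
  measurable E -> measurable_fun [set: T] f -> (forall x, 0 <= f x)%E ->
  (\int[mu]_x f x = \int[mu]_(x in E) f x + \int[mu]_(x in ~` E) f x)%E.
Proof.
move=> mE mf f0; rewrite -ge0_integral_setU//.
- by rewrite setUv.
- exact: measurableC.
- by rewrite setUv.
- by rewrite disj_set2E setICr.
Qed.

Lemma integral_le_three (H E : set T) (f : T -> \bar R) (a1 a2 a3 : R) :
  measurable H -> measurable E -> H `<=` E ->
  measurable_fun [set: T] f -> (forall x, 0 <= f x)%E ->
  (forall x, H x -> f x <= a1%:E)%E ->
  (forall x, E x -> ~ H x -> f x <= a2%:E)%E ->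
  (forall x, ~ E x -> f x <= a3%:E)%E ->
  (\int[mu]_x f x <= (a1 * fine (mu H) + a2 * (fine (mu E) - fine (mu H))
     + a3 * (1 - fine (mu E)))%:E)%E.
Proof.
move=> mH mE HE mf f0 f1 f2 f3.
have mEH : measurable (E `\` H) by exact: measurableD.
have mnE : measurable (~` E) by exact: measurableC.
rewrite (integral_split mE mf f0) -{1}(setDUK HE) ge0_integral_setU//; last 2 first.
- exact: measurable_funTS.
- by apply/disj_setPS => x [Hx []].
have muE : mu E = (fine (mu E))%:E by rewrite fineK// fin_num_measure.
have muH : mu H = (fine (mu H))%:E by rewrite fineK// fin_num_measure.
have muEH : mu (E `\` H) = (fine (mu E) - fine (mu H))%:E.
  rewrite measureD//; last exact: le_lt_trans (probability_le1 mu mE) (ltry _).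
  by rewrite (setIidr HE) EFinB; congr (_ - _)%E.
have munE : mu (~` E) = (1 - fine (mu E))%:E.
  by rewrite probability_setC// EFinB; congr (_ - _)%E.
rewrite !EFinD; apply: leeD; first apply: leeD.
- by rewrite EFinM -muH; exact: integral_le_cst.
- by rewrite EFinM -muEH; apply: integral_le_cst => // x [Ex nHx]; exact: f2.
- by rewrite EFinM -munE; exact: integral_le_cst.
Qed.

End integral_bounds.

Section markov.
Context {R : realType} {d : measure_display} {T : measurableType d}.
Context (P : probability T R).

Lemma markov_set (E : set T) (f : T -> R) (a : R) : 0 <= a ->
  measurable E -> measurable_fun [set: T] f -> (forall x, 0 <= f x) ->
  (forall x, E x -> a <= f x) ->
  (a%:E * P E <= \int[P]_x (f x)%:E)%E.
Proof.
move=> a0 mE mf f0 fa; rewrite -integral_cst//.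
have mEf : measurable_fun [set: T] (EFin \o f) by exact/measurable_EFinP.
apply: (@le_trans _ _ (\int[P]_(x in E) (f x)%:E)%E).
  by apply: ge0_le_integral => //; exact: measurable_funTS.
by apply: ge0_subset_integral => // x _; rewrite lee_fin.
Qed.

End markov.

(** * Two potentials of a run *)

Section learning.
Context {R : realType} {d p : nat} (A : 'M[R]_(p, d)) (b : 'cV[R]_p).
Context (pick : @rule R d).
Let X := polyhedron A b.
Hypothesis tb : tie_breaking X pick.
Context (Pc : probability 'cV[R]_d R) (rho : R) (n1 : nat).
Context {dW : measure_display} {Wt : measurableType dW}.
Context (C : Wt -> set 'cV[R]_d).
Hypothesis mC : measurable [set q : Wt * 'cV[R]_d | C q.1 q.2].

Let S : Type := (Wt * 'cV[R]_d * ('M[R]_(d, d.+1) * nat) * nat)%type.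

Local Notation st := (run_step A b pick C n1).

Definition retained_hard (q : Wt * 'cV[R]_d * ('M[R]_(d, d.+1) * nat) * nat * 'cV[R]_d)
    : bool :=
  `[<C q.1.1.1.1 q.2>] && `[<hard X pick q.1.1.1.2 q.2 (used_cols q.1.1.2)>].

(** The mass inside the prior of the costs for which the current matrix is not
    exact. *)
Definition risk (x : S) : \bar R := Pc [set c | retained_hard (x, c)].

(** Both conditions are constant along a run; the anchor must be feasible for
    [hard_mono]. *)
Definition valid (x : S) : bool :=
  `[<tolerance_event Pc rho (C x.1.1.1)>] && `[<X x.1.1.2>].

Lemma measurable_retained_hard : measurable_fun
  [set: Wt * 'cV[R]_d * ('M[R]_(d, d.+1) * nat) * nat * 'cV[R]_d] retained_hard.
Proof.
pose T := (Wt * 'cV[R]_d * ('M[R]_(d, d.+1) * nat) * nat * 'cV[R]_d)%type.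
have m1 : measurable_fun [set: T] (fun q => q.1) by exact: measurable_fst.
have m11 : measurable_fun [set: T] (fun q => q.1.1).
  exact: (measurableT_comp measurable_fst m1).
have m111 : measurable_fun [set: T] (fun q => q.1.1.1).
  exact: (measurableT_comp measurable_fst m11).
have m112 : measurable_fun [set: T] (fun q => q.1.1.2).
  exact: (measurableT_comp measurable_snd m11).
have m1121 : measurable_fun [set: T] (fun q => q.1.1.2.1).
  exact: (measurableT_comp measurable_fst m112).
have m1111 : measurable_fun [set: T] (fun q => q.1.1.1.1).
  exact: (measurableT_comp measurable_fst m111).
have m1112 : measurable_fun [set: T] (fun q => q.1.1.1.2).
  exact: (measurableT_comp measurable_snd m111).
have m2 : measurable_fun [set: T] (fun q => q.2) by exact: measurable_snd.
apply: measurable_and.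
  apply: measurable_asbool.
  by have := measurable_fun_pair m1111 m2 measurableT mC; rewrite setTI.
apply: (measurable_fun_nat_case (g := fun q : T => q.1.1.2.2)
  (f := fun r (q : T) => `[<hard X pick q.1.1.1.2 q.2 (cols r q.1.1.2.1)>])).
  exact: (measurableT_comp measurable_snd m112).
move=> r; apply: measurable_asbool.
have mq := measurable_fun_pair (measurable_fun_pair m1112 m2) m1121.
by have := mq measurableT _ (@measurable_hard_cols _ _ _ A b pick tb r); rewrite setTI.
Qed.

Lemma measurable_retained_hard_section x : measurable [set c | retained_hard (x, c)].
Proof.
have := measurable_set_of measurable_retained_hard => /(measurable_xsection x).
by rewrite xsectionE.
Qed.

Lemma measurable_C w : measurable (C w).
Proof. by have /(measurable_xsection w) := mC; rewrite xsectionE. Qed.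

Lemma measurable_risk : measurable_fun
  [set: Wt * 'cV[R]_d * ('M[R]_(d, d.+1) * nat) * nat] risk.
Proof.
have := measurable_fun_xsection Pc (measurable_set_of measurable_retained_hard).
by congr measurable_fun; apply/funext => x; rewrite /= xsectionE.
Qed.

Lemma measurable_tolerance :
  measurable [set w : Wt | tolerance_event Pc rho (C w)].
Proof.
have mN : measurable [set q : Wt * 'cV[R]_d | ~ C q.1 q.2] by exact: measurableC.
have := measurable_fun_xsection Pc mN => mf.
rewrite (_ : [set w | _] = [set w |
    ((Pc \o xsection [set q : Wt * 'cV[R]_d | ~ C q.1 q.2]) w <= rho%:E)%E]).
  rewrite -[Y in measurable Y]setTI; exact: emeasurable_fun_infty_c.
by apply/seteqP; split => w; rewrite /tolerance_event /= xsectionE.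
Qed.

Lemma measurable_valid : measurable_fun
  [set: Wt * 'cV[R]_d * ('M[R]_(d, d.+1) * nat) * nat] valid.
Proof.
have m11 : measurable_fun [set: S] (fun x => x.1.1).
  exact: (measurableT_comp measurable_fst measurable_fst).
apply: measurable_and; apply: measurable_asbool.
  have m := measurableT_comp measurable_fst m11.
  by have := m measurableT _ measurable_tolerance; rewrite setTI.
have m := measurableT_comp measurable_snd m11.
by have := m measurableT _ (measurable_polyhedron A b); rewrite setTI.
Qed.

(** Worth 1 at the end of a run with [k] columns and risk above [beta]. *)
Definition potential (k : nat) (beta : R) (x : S) : R :=
  if [&& valid x, (beta%:E < risk x)%E & (x.1.2.2 <= k)%N]
  then 2 ^+ k * 2^-1 ^+ x.1.2.2 * expR (- (beta / 2)) ^+ (n1 - x.2) else 0.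

(** Its mean decreases geometrically as long as samples are missing, because each
    retained sample halves it. *)
Definition shortfall (x : S) : R :=
  if `[<tolerance_event Pc rho (C x.1.1.1)>] && (x.2 < n1)%N
  then 2^-1 ^+ x.2 else 0.

Lemma potential_ge0 k beta x : 0 <= potential k beta x.
Proof. by rewrite /potential; case: ifP. Qed.

Lemma shortfall_ge0 x : 0 <= shortfall x.
Proof. by rewrite /shortfall; case: ifP. Qed.

Lemma measurable_potential k beta : measurable_fun
  [set: Wt * 'cV[R]_d * ('M[R]_(d, d.+1) * nat) * nat] (potential k beta).
Proof.
have m2 : measurable_fun [set: S] (fun x => x.2) by exact: measurable_snd.
have m122 : measurable_fun [set: S] (fun x => x.1.2.2).
  apply: (measurableT_comp measurable_snd).
  exact: (measurableT_comp measurable_snd measurable_fst).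
apply: measurable_fun_ifT => //.
  apply: measurable_and; first exact: measurable_valid.
  apply: measurable_and; last exact: measurable_fun_leq.
  apply: measurable_fun_lte => //; exact: measurable_risk.
apply: measurable_funM.
  apply: measurable_funM => //.
  exact: (measurableT_comp (_ : measurable_fun _ (fun n => 2^-1 ^+ n : R)) m122).
exact: (measurableT_comp
  (_ : measurable_fun _ (fun n => expR (- (beta / 2)) ^+ (n1 - n)%N)) m2).
Qed.

Lemma measurable_shortfall : measurable_fun
  [set: Wt * 'cV[R]_d * ('M[R]_(d, d.+1) * nat) * nat] shortfall.
Proof.
have m2 : measurable_fun [set: S] (fun x => x.2) by exact: measurable_snd.
have m11 : measurable_fun [set: S] (fun x => x.1.1).
  exact: (measurableT_comp measurable_fst measurable_fst).
apply: measurable_fun_ifT => //.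
  apply: measurable_and; last exact: measurable_fun_ltn.
  apply: measurable_asbool; have m := measurableT_comp measurable_fst m11.
  by have := m measurableT _ measurable_tolerance; rewrite setTI.
exact: (measurableT_comp (_ : measurable_fun _ (fun n => 2^-1 ^+ n : R)) m2).
Qed.

Lemma run_step_retain (x : S) c : (x.2 < n1)%N -> C x.1.1.1 c ->
  st (x, c) = (x.1.1, pick_loop X pick x.1.1.2 c x.1.2, (x.2 + 1)%N).
Proof. by move=> xn cC; rewrite /run_step /= xn asboolT. Qed.

Lemma run_step_skip (x : S) c : ~ ((x.2 < n1)%N /\ C x.1.1.1 c) -> st (x, c) = x.
Proof.
move=> nC; rewrite /run_step /=; case: ifP => // /andP[xn /asboolP cC].
by exfalso; apply: nC.
Qed.

(** The span of the columns grows, so fewer costs are hard. *)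
Lemma risk_run_step (x : S) c : X x.1.1.2 -> (risk (st (x, c)) <= risk x)%E.
Proof.
move=> Xx0; have [[xn cC]|nC] := pselect ((x.2 < n1)%N /\ C x.1.1.1 c); last first.
  by rewrite run_step_skip.
apply: le_measure; rewrite ?inE; try exact: measurable_retained_hard_section.
rewrite run_step_retain// => c' /andP[cC' /asboolP h]; apply/andP; split=> //.
apply/asboolP; apply: hard_mono tb Xx0 _ h => v.
exact: (@colspan_iter _ _ X pick d.+1 x.1.1.2 c x.1.2 v).
Qed.

Lemma potential_run_step k beta (x : S) c : (k <= d)%N -> (x.2 < n1)%N ->
  C x.1.1.1 c ->
  potential k beta (st (x, c)) <=
    potential k beta x * (expR (- (beta / 2)))^-1 * (if retained_hard (x, c) then 2^-1 else 1).
Proof.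
move=> kd xn cC; set th := expR _.
have th0 : 0 < th by exact: expR_gt0.
have rhs0 : 0 <= potential k beta x * th^-1 * (if retained_hard (x, c) then 2^-1 else 1).
  by rewrite !mulr_ge0 ?potential_ge0 ?invr_ge0 ?ltW//; case: ifP.
rewrite {1}/potential; case: ifP => [/and3P[vy ry ky]|//].
have yE := run_step_retain xn cC.
have vx : valid x by move: vy; rewrite yE.
have rx : (beta%:E < risk x)%E.
  by apply: lt_le_trans ry (risk_run_step _ _); case/andP: vx => _ /asboolP.
have rk : (x.1.2.2 <= (st (x, c)).1.2.2)%N by rewrite yE; exact: size_iter.
have kx : (x.1.2.2 <= k)%N by exact: leq_trans rk ky.
rewrite /potential vx rx kx /= -/th.
have -> : (n1 - x.2)%N = (n1 - (x.2 + 1)).+1 by rewrite addn1 subnSK.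
rewrite yE /= exprS.
have -> : 2 ^+ k * 2^-1 ^+ x.1.2.2 * (th * th ^+ (n1 - (x.2 + 1))) * th^-1 *
   (if retained_hard (x, c) then 2^-1 else 1) = 2 ^+ k *
   (2^-1 ^+ x.1.2.2 * (if retained_hard (x, c) then 2^-1 else 1)) *
   th ^+ (n1 - (x.2 + 1)) :> R.
  by field; rewrite gt_eqF.
apply: ler_wpM2r; first by rewrite exprn_ge0 ?ltW.
apply: ler_wpM2l; first by rewrite exprn_ge0.
case: ifPn => [/andP[_ /asboolP h]|].
  rewrite -exprSr; apply: ler_wiXn2l; rewrite ?invr_ge0 ?invf_le1 ?ler1n//.
  by apply: pick_loop_hard => //; exact: leq_trans kd.
rewrite /retained_hard /= asboolT//= => /asboolP h.
by rewrite /pick_loop iter_easy// mulr1.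
Qed.

(** With [q] the mass of the prior, [e] the risk and [th = exp (- beta / 2)], the
    mean is at most [th^-1 (q - e / 2) + 1 - q] times the potential. This is at
    most 1 because [th >= 1 - beta / 2], [q <= 1] and [e > beta]. *)
Lemma potential_drift k beta x : (k <= d)%N -> 0 <= beta ->
  (\int[Pc]_c (potential k beta (st (x, c)))%:E <= 1%:E * (potential k beta x)%:E)%E.
Proof.
move=> kd b0; rewrite mul1e.
have mf : measurable_fun [set: 'cV[R]_d] (fun c => (potential k beta (st (x, c)))%:E).
  apply/measurable_EFinP.
  apply: (measurableT_comp (measurable_potential k beta)).
  apply: (measurableT_comp (measurable_run_step tb n1 mC)).
  exact: pair1_measurable.
have [xn|xn] := leqP n1 x.2.
  rewrite (eq_integral (fun=> (potential k beta x)%:E)); last first.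
    by move=> c _; rewrite run_step_skip// => -[]; rewrite ltnNge xn.
  rewrite integral_cst// -[leRHS]mule1.
  by apply: lee_wpmul2l; [rewrite lee_fin potential_ge0|exact: probability_le1].
set th := expR (- (beta / 2)).
have th0 : 0 < th by exact: expR_gt0.
have := @integral_le_three _ _ _ Pc [set c | retained_hard (x, c)] (C x.1.1.1) _
  (potential k beta x * th^-1 * 2^-1) (potential k beta x * th^-1) (potential k beta x)
  (measurable_retained_hard_section x) (measurable_C x.1.1.1) _ mf.
move=> h; apply: (le_trans (h _ _ _ _ _)).
- by move=> c /andP[/asboolP].
- by move=> c; rewrite lee_fin potential_ge0.
- move=> c /= hc; rewrite lee_fin; have cC : C x.1.1.1 c by case/andP: hc => /asboolP.
  by have := potential_run_step beta kd xn cC; rewrite hc.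
- move=> c cC /negP/negbTE hc; rewrite lee_fin.
  by have := potential_run_step beta kd xn cC; rewrite hc mulr1.
- by move=> c cC; rewrite run_step_skip// => -[].
rewrite lee_fin -/(risk x).
have [->|K0] := eqVneq (potential k beta x) 0; first by rewrite !mul0r !addr0.
have rx : (beta%:E < risk x)%E.
  by apply: contra_neqT K0 => rx; rewrite /potential (negbTE rx) andbF.
have {rx} : beta < fine (risk x).
  by rewrite -lte_fin fineK// fin_num_measure//; exact: measurable_retained_hard_section.
have : fine (Pc (C x.1.1.1)) <= 1.
  by rewrite -lee_fin fineK ?fin_num_measure ?probability_le1//; exact: measurable_C.
have : 0 <= fine (Pc (C x.1.1.1)) by exact/fine_ge0/measure_ge0.
move: (fine (Pc _)) (fine (risk x)) => q e q0 q1 be.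
have K1 : 0 <= potential k beta x by exact: potential_ge0.
have thb : 1 - beta / 2 <= th by rewrite /th; have := expR_ge1Dx (- (beta / 2)).
suff : th^-1 * (q - e / 2) <= q.
  move=> h1; move: (potential k beta x) K1 => K K1.
  rewrite [leLHS](_ : _ = K * (th^-1 * (q - e / 2) + (1 - q))); last by field; rewrite gt_eqF.
  by rewrite ler_piMr//; lra.
rewrite mulrC ler_pdivrMr//.
apply: (@le_trans _ _ (q * (1 - beta / 2))); last exact: ler_wpM2l.
nra.
Qed.

Lemma shortfall_drift x : 0 <= rho <= 1 ->
  (\int[Pc]_c (shortfall (st (x, c)))%:E <= (1 - (1 - rho) / 2)%:E * (shortfall x)%:E)%E.
Proof.
move=> /andP[rho0 rho1].
have mf : measurable_fun [set: 'cV[R]_d] (fun c => (shortfall (st (x, c)))%:E).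
  apply/measurable_EFinP.
  apply: (measurableT_comp (measurable_shortfall)).
  apply: (measurableT_comp (measurable_run_step tb n1 mC)).
  exact: pair1_measurable.
have shortfall0 : shortfall x = 0 -> forall c, shortfall (st (x, c)) = 0.
  move=> xl c; have [[xn cC]|nC] := pselect ((x.2 < n1)%N /\ C x.1.1.1 c); last first.
    by rewrite run_step_skip.
  rewrite run_step_retain// /shortfall /=; move: xl; rewrite /shortfall xn andbT.
  by case: asboolP => // _ /eqP; rewrite expf_eq0 invr_eq0 pnatr_eq0 andbF.
have [xl|xl] := eqVneq (shortfall x) 0.
  by under eq_integral do rewrite shortfall0//; rewrite integral0 xl mule0.
have [tol xn] : tolerance_event Pc rho (C x.1.1.1) /\ (x.2 < n1)%N.
  by move: xl; rewrite /shortfall; case: ifP => [/andP[/asboolP]//|_]; rewrite eqxx.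
have := @integral_le_three _ _ _ Pc set0 (C x.1.1.1) _ 0 (shortfall x / 2) (shortfall x)
  measurable0 (measurable_C x.1.1.1) _ mf.
move=> h; apply: (le_trans (h _ _ _ _ _)) => //.
- by move=> c; rewrite lee_fin shortfall_ge0.
- move=> c cC _; rewrite lee_fin run_step_retain//.
  rewrite /shortfall /= !asboolT// xn /=; case: ifP => _.
    by rewrite addn1 exprSr.
  by rewrite divr_ge0 ?exprn_ge0.
- by move=> c cC; rewrite run_step_skip// => -[].
rewrite measure0 /= mul0r add0r subr0 -EFinM lee_fin.
have pC : 1 - rho <= fine (Pc (C x.1.1.1)).
  have mCx := measurable_C x.1.1.1.
  move: tol; rewrite /tolerance_event probability_setC//.
  rewrite -[X in (_ - X)%E]fineK ?fin_num_measure// -EFinB lee_fin; lra.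
have := shortfall_ge0 x; move: (shortfall x) (fine _) pC => l q; nra.
Qed.

End learning.

(** * Numerical bounds and the retained sample *)

Section numeric.
Context {R : realType}.

Lemma expR1_ge2 : 2 <= expR 1 :> R.
Proof. by have := expR_ge1Dx (1 : R); lra. Qed.

(** The exponent is [- (12 k + 2 log (e / delta))]. Using [exp (-1) <= 1 / 2], the
    part [- 2 k] gives [4 ^- k], one logarithm gives [delta / 2], and the rest is
    slack. *)
Lemma potential_start_le (n1 k : nat) (delta : R) : (0 < n1)%N -> 0 < delta < 1 ->
  2 ^+ k * expR (- (error_bound n1 k delta / 2)) ^+ n1 <= 2^-1 ^+ k.+1 * delta.
Proof.
move=> n0 /andP[d0 d1]; set L := ln (expR 1 / delta).
have eL : expR (- L) = delta / expR 1.
  by rewrite expRN /L lnK ?invf_div// posrE divr_gt0// expR_gt0.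
have L0 : 0 <= L.
  rewrite /L; apply: ln_ge0; rewrite ler_pdivlMr// mul1r.
  by apply: le_trans (ltW d1) _; have := expR1_ge2; lra.
have e1 : expR (-1) <= 2^-1 :> R.
  by rewrite expRN lef_pV2 ?posrE ?expR_gt0//; exact: expR1_ge2.
have -> : expR (- (error_bound n1 k delta / 2)) ^+ n1 =
    expR (- (12 * k%:R + 2 * L)).
  rewrite -expRM_natl; congr expR; rewrite /error_bound -/L.
  by field; rewrite pnatr_eq0 -lt0n.
have h : expR (- (12 * k%:R + 2 * L)) <= (2^-1 ^+ k) ^+ 2 * (delta / 2).
  apply: (@le_trans _ _ (expR ((2 * k)%:R * (-1) + (- L)))).
    rewrite ler_expR natrM; have : 0 <= k%:R :> R by [].
    move: (k%:R) => x; lra.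
  rewrite expRD expRM_natl -exprM mulnC; apply: ler_pM.
  - by rewrite exprn_ge0// expR_ge0.
  - exact: expR_ge0.
  - by apply: lerXn2r; rewrite ?nnegrE ?expR_ge0.
  - rewrite eL ler_pM2l// lef_pV2 ?posrE ?expR_gt0//; exact: expR1_ge2.
apply: le_trans (ler_wpM2l _ h) _; first by rewrite exprn_ge0.
rewrite expr2 exprS [leLHS](_ : _ = (2 ^+ k * 2^-1 ^+ k) * (2^-1 * 2^-1 ^+ k * delta)).
  by rewrite -exprMn divff ?expr1n ?mul1r// pnatr_eq0.
by ring.
Qed.

Lemma sum_half (n : nat) : \sum_(k < n) 2^-1 ^+ k.+1 <= 1 :> R.
Proof.
suff -> : \sum_(k < n) 2^-1 ^+ k.+1 = 1 - 2^-1 ^+ n :> R.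
  by rewrite gerBl exprn_ge0.
elim: n => [|n IHn]; first by rewrite big_ord0 expr0 subrr.
by rewrite big_ord_recr /= IHn exprS; field.
Qed.

Lemma geometric_small (K a e : R) : 0 <= a < 1 -> 0 < e ->
  exists N, K * a ^+ N < e.
Proof.
move=> /andP[a0 a1] e0.
have : (fun N => K * a ^+ N) @ \oo --> K * 0.
  by apply: cvgMr; apply: cvg_expr; rewrite ger0_norm.
rewrite mulr0 => /cvgrPdist_lt /(_ e e0)[N _ /(_ N (leqnn N))] /=.
rewrite sub0r normrN => h; exists N; apply: le_lt_trans h; exact: ler_norm.
Qed.

Lemma error_bound_mono n1 k k' (delta : R) : (0 < n1)%N -> (k <= k')%N ->
  error_bound n1 k delta <= error_bound n1 k' delta.
Proof.
move=> n0 kk; rewrite /error_bound ler_wpM2l ?divr_ge0// lerD2r.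
by rewrite ler_wpM2l// ler_nat.
Qed.

Lemma error_bound_ge0 n1 k (delta : R) : 0 < delta < 1 ->
  0 <= error_bound n1 k delta.
Proof.
move=> /andP[d0 d1]; rewrite /error_bound mulr_ge0 ?divr_ge0// addr_ge0 ?mulr_ge0//.
apply: ln_ge0; rewrite ler_pdivlMr// mul1r.
by apply: le_trans (ltW d1) _; have := expR1_ge2; lra.
Qed.

End numeric.

Section deterministic_run.
Context {R : realType} {d p : nat} (A : 'M[R]_(p, d)) (b : 'cV[R]_p).
Context (pick : @rule R d).
Let X := polyhedron A b.
Hypothesis tb : tie_breaking X pick.
Context {dW : measure_display} {Wt : measurableType dW}.
Context (C : Wt -> set 'cV[R]_d) (n1 : nat).
Local Notation st := (run_step A b pick C n1).

Lemma for_loop_rcons x0 cs c r (U : 'M[R]_(d, r)) r1 (U1 : 'M[R]_(d, r1))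
    r2 (U2 : 'M[R]_(d, r2)) :
  for_loop X pick x0 cs U U1 -> while_loop X pick x0 c U1 U2 ->
  for_loop X pick x0 (rcons cs c) U U2.
Proof.
move=> h; elim: h U2 => /= [{}r {}U U2 w|c' cs' {}r {}U r' U' r'' U'' w _ IH U2 w2].
  exact: for_cons w (for_nil _ _ _ _).
exact: for_cons w (IH _ w2).
Qed.

Definition start (z : Wt) (x0 : 'cV[R]_d) :
    Wt * 'cV[R]_d * ('M[R]_(d, d.+1) * nat) * nat := (z, x0, (0, 0%N), 0%N).

Definition run z x0 (c : nat -> 'cV[R]_d) N :=
  foldl (fun x t => st (x, t)) (start z x0) (mkseq c N).

(** When [n1] samples are retained the run stands still, so its sample comes from
    a prefix of length [N'] of the stream, which may be shorter than [N]. *)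
Lemma run_inv z x0 c0 c N : C z c0 -> Xstar X c0 x0 ->
  let x := run z x0 c N in
  [/\ x.1.1 = (z, x0), (x.2 <= n1)%N,
    independent_cols (dir (Xstar_set X (C z))) x.1.2 &
    exists N', let s := [seq t <- mkseq c N' | t \in C z] in
      [/\ size s = x.2, (x.2 < n1)%N -> N' = N &
          learns X pick x0 s (used_cols x.1.2)]].
Proof.
move=> c0C x0c0; have Xx0 : X x0 by case: x0c0.
have dirP c' x : C z c' -> Xstar X c' x -> x - x0 \in dir (Xstar_set X (C z)).
  move=> cC xX; apply: (spanP _).1; exists x, x0; split=> //.
  - by exists c'.
  - by exists c0.
elim: N => [|N [yE nn si [N' [sN' N'N lN]]]] /=.
  split=> //.
    exists [::]; split=> //; first by rewrite /free /= span_nil dimv0.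
    move=> v; rewrite span_nil memv0 => /eqP ->; exists 0 => //.
    by rewrite mulmx0.
  exists 0%N; split=> //=.
  rewrite (_ : used_cols _ = 0); last by apply/matrixP => i [].
  exact: for_nil.
rewrite /run mkseqS foldl_rcons -/(run z x0 c N).
have [[xn cC]|nC] := pselect (((run z x0 c N).2 < n1)%N /\ C z (c N)); last first.
  rewrite run_step_skip; last by rewrite yE.
  split=> //.
  have [xn|xn] := ltnP (run z x0 c N).2 n1; last first.
    by exists N'; split=> //; rewrite ltnNge xn.
  have NN := N'N xn; rewrite NN in sN' lN.
  have ncC : (c N \in C z) = false.
    by apply/negbTE; rewrite notin_setE => cC; apply: nC.
  by exists N.+1; rewrite mkseqS filter_rcons ncC.
rewrite run_step_retain//; last by rewrite yE.
rewrite yE /=.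
have [wl si'] := while_loop_iter (k := d.+1) tb Xx0 (fun x => dirP _ x cC) si
  (leq_addr _ _).
split=> //; first by rewrite addn1.
have NN := N'N xn; rewrite NN in sN' lN.
have cC' : c N \in C z by rewrite inE.
exists N.+1; rewrite mkseqS filter_rcons cC'; split=> //.
  by rewrite size_rcons sN' addn1.
apply: for_loop_rcons lN _; exact: wl.
Qed.

End deterministic_run.

(** * Learning from an estimated prior *)

Section guarantee.
Context {R : realType} {d p : nat} (A : 'M[R]_(p, d)) (b : 'cV[R]_p).
Hypothesis hne : polyhedron A b !=set0.
Hypothesis hbd : bounded_set (polyhedron A b).
Context (pick : @rule R d).
Let X := polyhedron A b.
Hypothesis tb : tie_breaking X pick.
Context (Pc : probability 'cV[R]_d R) (rho delta0 : R) (n1 : nat).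
Hypothesis hrho : 0 < rho < 1.
Hypothesis hn1 : (0 < n1)%N.

(** A cost that is not solved exactly is hard, hence either outside the prior or
    counted by the risk. *)
Lemma Exact_ge {dW : measure_display} {Wt : measurableType dW}
    (C : Wt -> set 'cV[R]_d)
    (mC : measurable [set q : Wt * 'cV[R]_d | C q.1 q.2]) z x0 s n (beta : R) :
  X x0 -> tolerance_event Pc rho (C z) ->
  (risk A b pick Pc C (z, x0, s, n) <= beta%:E)%E ->
  ((1 - rho - beta)%:E <= Pc [set c | Exact X (used_cols s) x0 c])%E.
Proof.
move=> Xx0 tol rb; pose H := [set c | hard X pick x0 c (used_cols s)].
have -> : [set c | Exact X (used_cols s) x0 c] = ~` H.
  apply/seteqP; split => c /=.
    move=> /(ExactP _ _ (Xstar_nonempty c hne hbd)) e h.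
    by move/(hardP _ _ tb Xx0): h; apply.
  move=> nh; apply/(ExactP _ _ (Xstar_nonempty c hne hbd)).
  by apply: contrapT => e; apply: nh; apply/(hardP _ _ tb Xx0).
have mCz := measurable_C mC z.
have mHC : measurable [set c | retained_hard A b pick C (z, x0, s, n, c)].
  exact: measurable_retained_hard_section.
have mH : measurable H.
  have m1 : measurable_fun [set: 'cV[R]_d] (fun c : 'cV[R]_d => (x0, c, s.1)).
    by apply: measurable_fun_pair => //; exact: measurable_fun_pair.
  by have := m1 measurableT _ (measurable_hard_cols tb s.2); rewrite setTI.
have HC : H `<=` ~` C z `|` [set c | retained_hard A b pick C (z, x0, s, n, c)].
  move=> c hc; have [cC|cC] := pselect (C z c); [right|by left].
  by rewrite /= /retained_hard /= !asboolT.
have PH : (Pc H <= (rho + beta)%:E)%E.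
  apply: (@le_trans _ _ (Pc (~` C z) + risk A b pick Pc C (z, x0, s, n))%E).
    have mnC : measurable (~` C z) by exact: measurableC.
    apply: (@le_trans _ _ (Pc (~` C z `|` [set c | retained_hard A b pick C (z, x0, s, n, c)]))).
      by apply: le_measure; rewrite ?inE//; exact: measurableU.
    exact: measureU2.
  by rewrite EFinD; exact: leeD.
rewrite probability_setC//; have PHf : Pc H \is a fin_num by exact: fin_num_measure.
move: PH; rewrite -(fineK PHf) -EFinB !lee_fin; lra.
Qed.

Lemma fresh_sample {dO dY} {Omega : measurableType dO}
    {Y : measurableType dY} (P : probability Omega R)
    (cs : nat -> {RV P >-> 'cV[R]_d}) (y : Omega -> Y) L :
  iid Pc cs -> measurable_fun [set: Omega] y -> independent_of_seq P y cs ->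
  fresh Pc cs y (iota 0 L).
Proof.
move=> [mi cd] my ind; split=> // B D mB mD.
pose T := [set t : L.-tuple 'cV[R]_d | forall i : 'I_L, D i (tnth t i)].
have mT : measurable T.
  rewrite (_ : T = \bigcap_(i in [set: 'I_L]) ((@tnth _ _)^~ i @^-1` D i)).
    apply: fin_bigcap_measurable => // i _; rewrite -[Z in measurable Z]setTI.
    exact: measurable_tnth.
  by apply/seteqP; split => t /= h i; [move=> _|]; exact: h.
have rT : rectangle cs (iota 0 L) D = (fun w => [tuple cs i w | i < L]) @^-1` T.
  rewrite /rectangle -bigcap_seq; apply/seteqP; split => w /= h i.
    by rewrite tnth_mktuple; apply: h; rewrite /= mem_iota /=.
  rewrite /= mem_iota add0n => /= iL.
  by have := h (Ordinal iL); rewrite tnth_mktuple.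
have := ind L _ _ mB mT; rewrite -rT => ->; congr (_ * _)%E.
rewrite [LHS](mi _ _ (iota_uniq 0 L) mD); congr EFin; apply: eq_bigr => i _.
by rewrite -(cd i).
Qed.

Section main.
Context {dO dW : measure_display} {Omega : measurableType dO}
  {Wt : measurableType dW} (P : probability Omega R) (W : {RV P >-> Wt})
  (C : Wt -> set 'cV[R]_d).
Hypothesis mC : measurable [set q : Wt * 'cV[R]_d | C q.1 q.2].
Context (c0 x0 : {RV P >-> 'cV[R]_d}) (cs : nat -> {RV P >-> 'cV[R]_d}).
Hypothesis hiid : iid Pc cs.
Hypothesis hind : independent_of_seq P (fun w => (W w, c0 w, x0 w)) cs.
Hypothesis hx0 : forall w, tolerance_event Pc rho (C (W w)) ->
  C (W w) (c0 w) /\ Xstar X (c0 w) (x0 w).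
Context (delta1 : R).
Hypothesis hdelta1 : 0 < delta1 < 1.

Let beta k := error_bound n1 k delta1.
Let state_at N w := run A b pick C n1 (W w) (x0 w) (cs^~ w) N.
Let tol : set Omega := [set w | tolerance_event Pc rho (C (W w))].
Let good N : set Omega := [set w | [/\ tol w, (state_at N w).2 = n1 &
  (risk A b pick Pc C (state_at N w) <= (beta (state_at N w).1.2.2)%:E)%E]].

Let s0 w := start (d := d) (W w) (x0 w).

Lemma fresh_start L : fresh Pc cs s0 (iota 0 L).
Proof.
have my : measurable_fun [set: Omega] (fun w => (W w, c0 w, x0 w)).
  by apply: measurable_fun_pair => //; exact: measurable_fun_pair.
have := fresh_sample L hiid my hind.
apply: (fresh_comp (f := fun q : Wt * 'cV[R]_d * 'cV[R]_d => start q.1.1 q.2)).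
do 2 (apply: measurable_fun_pair => //).
apply: measurable_fun_pair => //.
exact: (measurableT_comp measurable_fst measurable_fst).
Qed.

Lemma measurable_state_at N : measurable_fun [set: Omega]
  (state_at N : Omega -> Wt * 'cV[R]_d * ('M[R]_(d, d.+1) * nat) * nat).
Proof.
have ms := measurable_run_step tb n1 mC.
have := @fresh_walk _ _ _ P _ _ Pc _ cs _ _ _ ms s0 (iota 0 N) [::].
by rewrite cats0 => /(_ (iota_uniq 0 N) (fresh_start N))[].
Qed.

Lemma tol_inv N w : tol w ->
  [/\ (state_at N w).1.1 = (W w, x0 w), (state_at N w).2 <= n1,
    (state_at N w).1.2.2 <= d & valid A b Pc rho C (state_at N w)]%N.
Proof.
move=> tw; have [cC xc] := hx0 tw.
have [yE nn si _] := run_inv tb n1 (cs^~ w) N cC xc.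
split=> //; first by have [] := independent_cols_le si.
rewrite /valid yE /= !asboolT//; by case: xc.
Qed.

Lemma measurable_tol : measurable tol.
Proof.
rewrite -[Z in measurable Z]setTI.
exact: (measurable_funPT W measurableT _ (measurable_tolerance Pc rho mC)).
Qed.

Lemma measurable_risk_at N :
  measurable_fun [set: Omega] (fun w => risk A b pick Pc C (state_at N w)).
Proof. exact: (measurableT_comp (measurable_risk tb Pc mC) (measurable_state_at N)). Qed.

Lemma measurable_cols_at N : measurable_fun [set: Omega] (fun w => (state_at N w).1.2.2).
Proof.
apply: (measurableT_comp measurable_snd).
apply: (measurableT_comp measurable_snd).
exact: (measurableT_comp measurable_fst (measurable_state_at N)).
Qed.

Lemma measurable_count_at N : measurable_fun [set: Omega] (fun w => (state_at N w).2).
Proof. exact: (measurableT_comp measurable_snd (measurable_state_at N)). Qed.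

Lemma measurable_good N : measurable (good N).
Proof.
have -> : good N = tol `&` ([set w | (state_at N w).2 == n1] `&`
  [set w | (risk A b pick Pc C (state_at N w) <= (beta (state_at N w).1.2.2)%:E)%E]).
  by apply/seteqP; split => w; [move=> [? /eqP ? ?]|move=> [? [/eqP ? ?]]].
apply: measurableI; first exact: measurable_tol.
apply: measurableI; apply: measurable_set_of.
  apply: measurable_fun_eqn => //; exact: measurable_count_at.
apply: measurable_fun_lee; first exact: measurable_risk_at.
apply/measurable_EFinP.
exact: (measurableT_comp (_ : measurable_fun _ beta) (measurable_cols_at N)).
Qed.

Let few N : set Omega := [set w | tol w /\ ((state_at N w).2 < n1)%N].
Let bad N (k : nat) : set Omega := [set w | [/\ tol w, (state_at N w).2 = n1,
  (state_at N w).1.2.2 = k & ((beta k)%:E < risk A b pick Pc C (state_at N w))%E]].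

Lemma measurable_few N : measurable (few N).
Proof.
apply: measurableI; first exact: measurable_tol.
apply: (@measurable_set_of _ _ (fun w => (state_at N w).2 < n1)%N).
apply: measurable_fun_ltn => //; exact: measurable_count_at.
Qed.

Lemma measurable_bad N k : measurable (bad N k).
Proof.
have -> : bad N k = tol `&` ([set w | (state_at N w).2 == n1] `&`
  ([set w | (state_at N w).1.2.2 == k] `&`
  [set w | ((beta k)%:E < risk A b pick Pc C (state_at N w))%E])).
  by apply/seteqP; split => w; [move=> [? /eqP ? /eqP ? ?]
    |move=> [? [/eqP ? [/eqP ? ?]]]].
apply: measurableI; first exact: measurable_tol.
apply: measurableI; first apply: measurable_set_of.
  apply: measurable_fun_eqn => //; exact: measurable_count_at.
apply: measurableI; apply: measurable_set_of.
  apply: measurable_fun_eqn => //; exact: measurable_cols_at.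
by apply: measurable_fun_lte => //; exact: measurable_risk_at.
Qed.

(** The second potential is at least [2 ^- n1] while a sample is missing. *)
Lemma few_le N :
  (P (few N) <= (2 ^+ n1 * (1 - (1 - rho) / 2) ^+ N)%:E)%E.
Proof.
have ms := measurable_run_step tb n1 mC.
have ml : measurable_fun
    [set: Wt * 'cV[R]_d * ('M[R]_(d, d.+1) * nat) * nat] (EFin \o shortfall Pc rho n1 C).
  by apply/measurable_EFinP; exact: measurable_shortfall.
have h1 := @markov_set _ _ _ P (few N) (fun w => shortfall Pc rho n1 C (state_at N w))
  (2^-1 ^+ n1) _ (measurable_few N) _ _ _.
have [rho0 rho1] := andP hrho.
have a0 : 0 <= 1 - (1 - rho) / 2 by lra.
have := @integral_walk_le _ _ _ P _ _ Pc _ cs _ _ _ ms (EFin \o shortfall Pc rho n1 C)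
  (1 - (1 - rho) / 2) s0 (iota 0 N) a0 ml _ _ (iota_uniq 0 N) (fresh_start N).
move=> h2.
have h3 : (\int[P]_w (shortfall Pc rho n1 C (s0 w))%:E <= 1)%E.
  apply: (@le_trans _ _ (\int[P]_w (cst 1 w))%E).
    apply: ge0_le_integral => //.
    - by move=> w _; rewrite lee_fin shortfall_ge0.
    - by apply: (measurableT_comp ml); have [] := fresh_start 0.
    - by move=> w _; rewrite lee_fin /shortfall /=; case: ifP.
  by rewrite integral_cst// mul1e; exact: probability_le1.
have h4 : ((2^-1 ^+ n1)%:E * P (few N) <= ((1 - (1 - rho) / 2) ^+ N)%:E)%E.
  apply: le_trans (h1 _ _ _ _) _.
  - by rewrite exprn_ge0.
  - by apply/measurable_EFinP; exact: (measurableT_comp ml (measurable_state_at N)).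
  - by move=> w; exact: shortfall_ge0.
  - move=> w [tw nw]; rewrite /shortfall nw andbT.
    have [-> _ _ _] := tol_inv N tw; rewrite asboolT//.
    by apply: ler_wiXn2l; rewrite ?invr_ge0 ?invf_le1 ?ler1n// ltnW.
  apply: le_trans (h2 _ _) _.
  - by move=> x; rewrite lee_fin shortfall_ge0.
  - by move=> x; apply: shortfall_drift => //; rewrite !ltW.
  rewrite size_iota -[leRHS]mule1; apply: lee_wpmul2l => //.
  by rewrite lee_fin exprn_ge0.
have Pf : P (few N) \is a fin_num by exact: fin_num_measure (measurable_few N).
move: h4; rewrite -(fineK Pf) -EFinM !lee_fin exprVn.
by rewrite ler_pdivrMl// exprn_gt0.
Qed.

Lemma bad_le N k : (k <= d)%N ->
  (P (bad N k) <= (2^-1 ^+ k.+1 * delta1)%:E)%E.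
Proof.
move=> kd; have ms := measurable_run_step tb n1 mC.
set V := potential A b pick Pc rho n1 C k (beta k).
have mV : measurable_fun
    [set: Wt * 'cV[R]_d * ('M[R]_(d, d.+1) * nat) * nat] (EFin \o V).
  by apply/measurable_EFinP; exact: measurable_potential.
have h1 := @markov_set _ _ _ P (bad N k) (fun w => V (state_at N w)) 1 _
  (measurable_bad N k) _ _ _.
have := @integral_walk_le _ _ _ P _ _ Pc _ cs _ _ _ ms (EFin \o V)
  1 s0 (iota 0 N) ler01 mV _ _ (iota_uniq 0 N) (fresh_start N).
move=> h2; rewrite -[leLHS]mul1e; apply: le_trans (h1 _ _ _ _) _ => //.
- by apply/measurable_EFinP; exact: (measurableT_comp mV (measurable_state_at N)).
- by move=> w; exact: potential_ge0.
- move=> w [tw nw rw bw]; rewrite /V /potential bw rw leqnn.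
  have [_ _ _ ->] := tol_inv N tw; rewrite /= nw subnn expr0 mulr1.
  by rewrite -exprMn divff ?expr1n// pnatr_eq0.
apply: le_trans (h2 _ _) _.
- by move=> x; rewrite lee_fin potential_ge0.
- by move=> x; apply: potential_drift => //; exact: error_bound_ge0.
rewrite expr1n mul1e.
apply: (@le_trans _ _ (\int[P]_w (cst (2^-1 ^+ k.+1 * delta1)%:E w))%E).
  apply: ge0_le_integral => //.
  - by move=> w _; rewrite lee_fin potential_ge0.
  - by apply: (measurableT_comp mV); have [] := fresh_start 0.
  - move=> w _; rewrite lee_fin /V /potential /=; case: ifP => _.
      by rewrite expr0 mulr1 subn0; exact: potential_start_le.
    by rewrite mulr_ge0 ?exprn_ge0//; case/andP: hdelta1 => /ltW.
rewrite integral_cst// -[leRHS]mule1; apply: lee_wpmul2l.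
  by rewrite lee_fin mulr_ge0 ?exprn_ge0//; case/andP: hdelta1 => /ltW.
exact: probability_le1.
Qed.

(** The number of columns is random; the union bound over its possible values
    costs only a geometric series. *)
Lemma good_ge N : ((1 - delta0)%:E <= P tol)%E ->
  ((1 - delta0 - delta1 - 2 ^+ n1 * (1 - (1 - rho) / 2) ^+ N)%:E <= P (good N))%E.
Proof.
move=> htol.
have cover : tol `<=` good N `|` (few N `|` \big[setU/set0]_(k < d.+1) bad N k).
  move=> w tw; have [_ nn rd _] := tol_inv N tw.
  move: nn; rewrite leq_eqVlt => /orP[/eqP nw|nw]; last by right; left.
  have [rb|rb] := leP (risk A b pick Pc C (state_at N w)) (beta (state_at N w).1.2.2)%:E.
    by left.
  right; right; rewrite -bigcup_mkord.
  by exists (state_at N w).1.2.2 => //=; rewrite ltnS.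
have mU : measurable (\big[setU/set0]_(k < d.+1) bad N k).
  by apply: bigsetU_measurable => k _; exact: measurable_bad.
have mf := measurable_few N; have mg := measurable_good N.
have PU : (P (\big[setU/set0]_(k < d.+1) bad N k) <= delta1%:E)%E.
  apply: le_trans (_ : (\sum_(k < d.+1) P (bad N k) <= _)%E).
    by apply: Boole_inequality => k _; exact: measurable_bad.
  apply: (@le_trans _ _ (\sum_(k < d.+1) (2^-1 ^+ k.+1 * delta1)%:E)%E).
    by apply: lee_sum => k _; apply: bad_le; rewrite -ltnS.
  rewrite sumEFin lee_fin -mulr_suml ler_piMl ?sum_half//.
  by case/andP: hdelta1 => /ltW.
have PT : (P tol <= P (good N) + ((2 ^+ n1 * (1 - (1 - rho) / 2) ^+ N)%:E + delta1%:E))%E.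
  apply: (@le_trans _ _ (P (good N `|` (few N `|` \big[setU/set0]_(k < d.+1) bad N k)))).
    apply: le_measure; rewrite ?inE//; first exact: measurable_tol.
    by apply: measurableU => //; exact: measurableU.
  set U := \big[setU/set0]_(k < d.+1) bad N k in mU PU *.
  have mfU : measurable (few N `|` U) by exact: measurableU.
  apply: (@le_trans _ _ (P (good N) + P (few N `|` U))%E).
    exact: measureU2.
  apply: leeD => //; apply: (@le_trans _ _ (P (few N) + P U)%E).
    exact: measureU2.
  by apply: leeD => //; exact: few_le.
have := le_trans htol PT.
have Pg : P (good N) \is a fin_num by exact: fin_num_measure.
rewrite -(fineK Pg) -!EFinD !lee_fin; lra.
Qed.

Lemma guarantee_main : ((1 - delta0)%:E <= P tol)%E ->
  prob_ge P
    [set w | tolerance_event Pc rho (C (W w)) /\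
       exists s : n1.-tuple 'cV[R]_d,
         first_retained (C (W w)) (fun i => cs i w) s /\
         exists r (U : 'M[R]_(d, r)), learns X pick (x0 w) s U /\
           ((1 - rho -
             error_bound n1 (\dim (dir (Xstar_set X (C (W w))))) delta1)%:E
            <= Pc [set c | Exact X U (x0 w) c])%E]
    (1 - delta0 - delta1).
Proof.
move=> htol; have mG : measurable (\bigcup_N good N).
  by apply: bigcupT_measurable => N; exact: measurable_good.
exists (\bigcup_N good N); first split=> //.
  move=> w [N _ [tw nw rw]]; split=> //.
  have [cC xc] := hx0 tw.
  have [yE _ si [N' [sN' _ lN]]] := run_inv tb n1 (cs^~ w) N cC xc.
  have [rd _] := independent_cols_le si.
  have sz : size [seq t <- mkseq (cs^~ w) N' | t \in C (W w)] == n1.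
    by apply/eqP; rewrite sN'.
  exists (Tuple sz); split; first by exists N'.
  exists (state_at N w).1.2.2, (used_cols (state_at N w).1.2); split=> //.
  apply: le_trans (_ : ((1 - rho - beta (state_at N w).1.2.2)%:E <= _)%E).
    by rewrite lee_fin lerD2l lerN2; exact: error_bound_mono.
  have rnE' : (W w, x0 w, (state_at N w).1.2, (state_at N w).2) = state_at N w.
    by rewrite [RHS]surjective_pairing [in RHS](surjective_pairing (state_at N w).1) yE.
  have Xx0 : X (x0 w) by case: xc.
  apply: (@Exact_ge _ _ C mC (W w) (x0 w) (state_at N w).1.2 (state_at N w).2 _ Xx0 tw).
  by rewrite rnE'.
(* The good events increase with [N]; [N] is chosen so that few runs are short
   of samples. *)
apply/lee_addgt0Pr => e e0.
have [rho0 rho1] := andP hrho.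
have [|N hN] := @geometric_small R (2 ^+ n1) (1 - (1 - rho) / 2) e _ e0.
  by apply/andP; split; lra.
have PG : (P (good N) <= P (\bigcup_N good N))%E.
  apply: le_measure; rewrite ?inE//; first exact: measurable_good.
  exact: bigcup_sup.
apply: le_trans (_ : (P (good N) + e%:E <= _)%E); last exact: leeD.
have Pg : P (good N) \is a fin_num by exact: fin_num_measure (measurable_good N).
have := good_ge N htol; rewrite -(fineK Pg) -EFinD !lee_fin; lra.
Qed.

End main.

Lemma estimated_prior_guarantee {dO dW : measure_display}
    {Omega : measurableType dO} {Wt : measurableType dW}
    (P : probability Omega R) (W : {RV P >-> Wt}) (C : Wt -> set 'cV[R]_d) :
  estimated_prior Pc rho delta0 W C ->
  learning_guarantee X Pc rho delta0 pick n1 W C.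
Proof.
move=> [mC _ htol] c0 x0 cs hiid hind hx0 delta1 hdelta1.
exact: (guarantee_main mC hiid hind hx0 hdelta1 htol).
Qed.

End guarantee.

(** * Binomial tails and order statistics *)

Section binomial_tail.
Context {R : realType} (rho : R).

(** The upper tail at [k] of a binomial law with [n] trials of success probability
    [1 - rho] ([tail_binomial]), computed by conditioning on one trial. *)
Fixpoint tail (n k : nat) : R :=
  match n, k with
  | _, 0%N => 1
  | 0%N, _.+1 => 0
  | n'.+1, k'.+1 => rho * tail n' k'.+1 + (1 - rho) * tail n' k'
  end.

Lemma tail0 n : tail n 0 = 1. Proof. by case: n. Qed.

Lemma tail_ge0 n k : 0 <= rho <= 1 -> 0 <= tail n k.
Proof.
move=> /andP[r0 r1]; elim: n k => [|n IHn] [|k] //=.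
by rewrite addr_ge0// mulr_ge0// subr_ge0.
Qed.

Lemma tail_le1 n k : 0 <= rho <= 1 -> tail n k <= 1.
Proof.
move=> /andP[r0 r1]; elim: n k => [|n IHn] [|k] //=.
have := IHn k.+1; have := IHn k; nra.
Qed.

Lemma tail_anti n k : 0 <= rho <= 1 -> tail n k.+1 <= tail n k.
Proof.
move=> r01; have /andP[r0 r1] := r01; elim: n k => [|n IHn] [|k] //=.
  by have := tail_le1 n.+1 1 r01; rewrite /= ?tail0.
by have := IHn k.+1; have := IHn k; nra.
Qed.

Let f n i : R := (1 - rho) ^+ i * rho ^+ (n - i) *+ 'C(n, i).

Lemma tail_sum n k : tail n k = \sum_(k <= i < n.+1) f n i.
Proof.
have f_big m : f m m.+1 = 0 by rewrite /f bin_small// mulr0n.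
have pascal m i : (i <= m)%N -> f m.+1 i.+1 = rho * f m i.+1 + (1 - rho) * f m i.
  move=> im; rewrite /f binS mulrnDr subSS; congr (_ + _).
    have [im'|mi] := ltnP i m; last first.
      by rewrite bin_small ?ltnS// !mulr0n mulr0.
    by rewrite -(subnSK im') [rho ^+ _.+1]exprS mulrCA mulrnAr.
  by rewrite exprS -mulrA mulrnAr.
elim: n k => [|n IHn] [|k].
- by rewrite big_nat1 /f /= expr0 mulr1 bin0.
- by rewrite big_geq.
- rewrite tail0 /f -[LHS](expr1n _ n.+1) -{1}(subrK rho 1) addrC exprDn.
  rewrite big_mkord; apply: eq_bigr => i _; by rewrite mulrC.
rewrite /= !IHn big_add1 /=.
rewrite [RHS](eq_big_nat _ _ (F2 := fun i => rho * f n i.+1 + (1 - rho) * f n i)); last first.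
  by move=> i /andP[_]; rewrite ltnS => im; exact: pascal.
rewrite big_split /= -!mulr_sumr; congr (_ * _ + _).
transitivity (\sum_(k.+1 <= i < n.+2) f n i); last by rewrite big_add1.
have [kn|nk] := leqP k n; last by rewrite !big_geq// ltnW.
by rewrite [RHS]big_nat_recr //= f_big addr0.
Qed.

Lemma tail_binomial n k : 0 < rho < 1 ->
  binomial_prob n (1 - rho) [set j | (k <= j)%N] = (tail n k)%:E.
Proof.
move=> /andP[r0 r1]; have p0 : 0 <= 1 - rho by lra.
have p1 : (NngNum p0)%:num <= 1 by rewrite /=; lra.
rewrite (binomial_probE n p1) tail_sum.
transitivity (\sum_(i < n.+1) (if (k <= i)%N then f n i else 0)%:E)%E.
  apply: eq_bigr => i _; rewrite diracE.
  have -> : (nat_of_ord i \in [set j | (k <= j)%N]) = (k <= i)%N.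
    by apply/idP/idP; rewrite inE.
  case: ifP => _; rewrite ?mule1 ?mule0//= /f /unstable.onem.
  by rewrite opprB addrCA subrr addr0.
rewrite sumEFin; congr EFin; rewrite -big_mkcond /=.
rewrite -(big_mkord (fun i => (k <= i)%N) (f n)).
have [kn|nk] := leqP k n.+1; last first.
  rewrite [RHS]big_geq ?(ltnW nk)// big_nat_cond big1// => i /andP[/andP[_ iN]].
  by rewrite leqNgt (leq_trans iN (ltnW nk)).
rewrite (big_cat_nat (n := k)) //= big_nat_cond big1 ?add0r.
  rewrite big_nat_cond [RHS]big_nat_cond; apply: eq_bigl => i.
  by case: (k <= i)%N; rewrite ?andbF ?andbT.
by move=> i /andP[/andP[_ ik]]; rewrite leqNgt ik.
Qed.

End binomial_tail.

Section order_statistics.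
Context {R : realType}.

(** For [k = size S + 1] both sides hold, the left one by the default value. *)
Lemma order_statP (S : seq R) k x : (0 < k)%N ->
  (x%:E <= order_stat S k)%E <-> (count (fun y => (y < x)%R) S < k)%N.
Proof.
move=> k0; rewrite /order_stat; set t := sort <=%R S.
have st : sorted <=%O t by apply: sort_sorted; exact: le_total.
rewrite -(count_sort <=%R (fun y => (y < x)%R) S) -/t.
have [kt|tk] := ltnP k.-1 (size t); last first.
  rewrite nth_default ?size_map// leey; split=> // _.
  by rewrite (leq_ltn_trans (count_size _ _))// (leq_ltn_trans tk)// prednK.
rewrite (nth_map 0)// lee_fin; split=> [xt|ct].
  rewrite -(prednK k0) ltnS leqNgt; apply/negP => /(nth_count_lt 0 st).
  by rewrite ltNge xt.
by apply: nth_count_ge => //; rewrite kt andbT -ltnS prednK.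
Qed.

Lemma order_stat_fin (S : seq R) k :
  (order_stat S k = +oo%E /\ (size S <= k.-1)%N) \/
  exists t, order_stat S k = t%:E /\ (k.-1 < count (fun y => (y <= t)%R) S)%N.
Proof.
rewrite /order_stat; set t := sort <=%R S.
have st : sorted <=%O t by apply: sort_sorted; exact: le_total.
have szt : size t = size S by rewrite size_sort.
have [kt|tk] := ltnP k.-1 (size t); last first.
  by left; rewrite nth_default ?size_map// -szt.
right; exists (nth 0 t k.-1); rewrite (nth_map 0)//; split=> //.
rewrite -(count_sort <=%R) -/t ltnNge; apply/negP => ct.
have := @nth_count_gt _ _ (nth 0 t k.-1) 0 t k.-1 st.
by rewrite ct kt ltxx => /(_ isT).
Qed.

End order_statistics.

Lemma k_calP {R : realType} (rho delta0 : R) m : 0 < rho < 1 -> 0 < delta0 ->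
  (0 < k_cal rho delta0 m)%N /\ tail rho m (k_cal rho delta0 m) <= delta0.
Proof.
move=> hrho hd; rewrite /k_cal; case: arg_minnP => /=.
  rewrite tail_binomial// lee_fin (_ : tail _ _ _ = 0) ?ltW// tail_sum.
  by rewrite big_geq.
by move=> i /andP[i0]; rewrite tail_binomial// lee_fin.
Qed.

(** * Levels of a score *)

Section low_levels.
Context {R : realType} {d : measure_display} {T : measurableType d}.
Context (mu : probability T R) (s : T -> R).
Hypothesis ms : measurable_fun [set: T] s.

Definition cdf_at (t : R) : \bar R := mu [set x | s x <= t].

Lemma measurable_level t : measurable [set x | s x <= t].
Proof.
apply: (@measurable_set_of _ _ (fun x => s x <= t)).
exact: measurable_fun_ler.
Qed.

Lemma cdf_at_le t t' : t <= t' -> (cdf_at t <= cdf_at t')%E.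
Proof.
move=> tt'; apply: le_measure; rewrite ?inE; try exact: measurable_level.
by move=> x /= /le_trans; apply.
Qed.

(** The levels [t] with [P (s <= t) < a] form an initial segment. If it has a
    largest element, the event is a single sublevel set. Otherwise it is the
    increasing union of the sublevel sets at the first [n] rational levels of
    the segment, and each of these unions has measure at most [a]. *)
Lemma low_level_prob (a : R) : 0 <= a ->
  measurable [set x | (cdf_at (s x) < a%:E)%E] ->
  (mu [set x | (cdf_at (s x) < a%:E)%E] <= a%:E)%E.
Proof.
move=> a0 mB; set B := [set x | _].
have [[tm [tma tmax]]|nomax] := pselect (exists tm, (cdf_at tm < a%:E)%E /\
    forall t, (cdf_at t < a%:E)%E -> t <= tm).
  apply: le_trans (ltW tma); apply: le_measure; rewrite ?inE//.
    exact: measurable_level.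
  by move=> x /tmax.
pose G n := [set x | exists q : rat, [/\ (cdf_at (ratr q) < a%:E)%E,
  (pickle q < n)%N & s x <= ratr q]].
have Glow n : G n = set0 \/ exists t, (cdf_at t < a%:E)%E /\ G n = [set x | s x <= t].
  elim: n => [|n [G0|[t [ta Gt]]]].
  - by left; apply/seteqP; split => x // [q []].
  - have [[q [qa qn]]|nq] := pselect (exists q : rat,
        (cdf_at (ratr q) < a%:E)%E /\ pickle q = n).
      right; exists (ratr q); split => //; apply/seteqP; split => x /=.
        move=> [q' [q'a q'n xq']]; have [q'n'|q'n'] := ltnP (pickle q') n.
          by have : G n x by [exists q'; split]; rewrite G0.
        have : pickle q' = n by apply/eqP; rewrite eqn_leq q'n' -ltnS q'n.
        by rewrite -qn => /(pcan_inj pickleK) <-.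
      by move=> xq; exists q; split => //; rewrite qn.
    left; apply/seteqP; split => x // [q' [q'a q'n xq']].
    have [q'n'|q'n'] := ltnP (pickle q') n.
      by have : G n x by [exists q'; split]; rewrite G0.
    by apply: nq; exists q'; split=> //; apply/eqP; rewrite eqn_leq q'n' -ltnS q'n.
  - right; have [[q [qa qn]]|nq] := pselect (exists q : rat,
        (cdf_at (ratr q) < a%:E)%E /\ pickle q = n).
      exists (Num.max t (ratr q)); split; first by rewrite /Num.max; case: ifP.
      apply/seteqP; split => x /=.
        move=> [q' [q'a q'n xq']]; have [q'n'|q'n'] := ltnP (pickle q') n.
          have : G n x by exists q'; split.
          by rewrite Gt /= le_max => ->.
        have : pickle q' = n by apply/eqP; rewrite eqn_leq q'n' -ltnS q'n.
        by rewrite -qn => /(pcan_inj pickleK) <-; rewrite le_max xq' orbT.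
      rewrite le_max => /orP[xt|xq].
        have : G n x by rewrite Gt.
        by move=> [q' [q'a q'n xq']]; exists q'; split => //; exact: ltnW.
      by exists q; split => //; rewrite qn.
    exists t; split => //; apply/seteqP; split => x /=.
      move=> [q' [q'a q'n xq']]; have [q'n'|q'n'] := ltnP (pickle q') n.
        by have : G n x by [exists q'; split]; rewrite Gt.
      by exfalso; apply: nq; exists q'; split=> //; apply/eqP;
        rewrite eqn_leq q'n' -ltnS q'n.
    move=> xt; have : G n x by rewrite Gt.
    by move=> [q' [q'a q'n xq']]; exists q'; split => //; exact: ltnW.
have mG n : measurable (G n).
  by case: (Glow n) => [->//|[t [_ ->]]]; exact: measurable_level.
have GB : \bigcup_n G n = B.
  apply/seteqP; split=> [x [n _ [q [qa _ xq]]]|x xB].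
    exact: le_lt_trans (cdf_at_le xq) qa.
  have [t [ta xt]] : exists t, (cdf_at t < a%:E)%E /\ s x < t.
    apply: contrapT => nt; apply: nomax; exists (s x); split => // t ta.
    by rewrite leNgt; apply/negP => xt; apply: nt; exists t.
  have [q] := rat_in_itvoo xt; rewrite in_itv /= => /andP[xq qt].
  exists (pickle q).+1 => //; exists q; split => //; last exact: ltW.
  exact: le_lt_trans (cdf_at_le (ltW qt)) ta.
have cv : (mu \o G) n @[n --> \oo] --> mu (\bigcup_n G n).
  apply: nondecreasing_cvg_mu => //; first exact: bigcupT_measurable.
  move=> m n mn; apply/subsetPset => x [q [qa qm xq]]; exists q; split => //.
  exact: leq_trans qm mn.
rewrite -GB -(cvg_lim _ cv)//; apply: lime_le; first by apply/cvg_ex; exists (mu (\bigcup_n G n)).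
apply: nearW => n /=; case: (Glow n) => [->|[t [ta ->]]].
  by rewrite measure0 lee_fin.
exact: ltW.
Qed.

End low_levels.

(** * Calibrated priors *)

Section calibration.
Context {R : realType} {d : nat} (Pc : probability 'cV[R]_d R) (rho delta0 : R).
Hypothesis hrho : 0 < rho < 1.
Hypothesis hdelta0 : 0 < delta0 < 1.
Context (nfit m : nat) (s : nfit.-tuple 'cV[R]_d -> 'cV[R]_d -> R).
Hypothesis ms : measurable_fun [set: nfit.-tuple 'cV[R]_d * 'cV[R]_d]
  (fun q => s q.1 q.2).

Let k := k_cal rho delta0 m.

(** The sublevel set at a low score leaves out more than [rho]. *)
Definition low_score (D : nfit.-tuple 'cV[R]_d) (c : 'cV[R]_d) : bool :=
  `[<(cdf_at Pc (s D) (s D c) < (1 - rho)%:E)%E>].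

Lemma measurable_score D : measurable_fun [set: 'cV[R]_d] (s D).
Proof. exact: (measurableT_comp ms (pair1_measurable D)). Qed.

Lemma measurable_low_score : measurable_fun [set: nfit.-tuple 'cV[R]_d * 'cV[R]_d]
  (fun q => low_score q.1 q.2).
Proof.
apply: measurable_asbool.
pose Q := [set q : nfit.-tuple 'cV[R]_d * 'cV[R]_d * 'cV[R]_d |
  s q.1.1 q.2 <= s q.1.1 q.1.2].
have mQ : measurable Q.
  apply: (@measurable_set_of _ _ (fun q : nfit.-tuple 'cV[R]_d * 'cV[R]_d * 'cV[R]_d =>
    s q.1.1 q.2 <= s q.1.1 q.1.2)).
  apply: measurable_fun_ler; last exact: (measurableT_comp ms measurable_fst).
  have mp : measurable_fun [set: nfit.-tuple 'cV[R]_d * 'cV[R]_d * 'cV[R]_d]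
      (fun q => (q.1.1, q.2)).
    apply: measurable_fun_pair; last exact: measurable_snd.
    exact: (measurableT_comp measurable_fst measurable_fst).
  exact: (measurableT_comp ms mp).
have := measurable_fun_xsection Pc mQ => mf.
apply: (@measurable_set_of _ _ (fun q : nfit.-tuple 'cV[R]_d * 'cV[R]_d =>
  (cdf_at Pc (s q.1) (s q.1 q.2) < (1 - rho)%:E)%E)).
apply: measurable_fun_lte => //.
apply: eq_measurable_fun mf => q _ /=.
by rewrite xsectionE.
Qed.

Lemma low_score_prob D : (Pc [set c | low_score D c] <= (1 - rho)%:E)%E.
Proof.
have mD := measurable_score D.
have e : [set c | low_score D c] = [set c | (cdf_at Pc (s D) (s D c) < (1 - rho)%:E)%E].
  by apply/seteqP; split => c /asboolP.
rewrite e; apply: low_level_prob => //; first by case/andP: hrho => _ /ltW; rewrite subr_ge0.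
rewrite -e; have := measurable_set_of measurable_low_score => /(measurable_xsection D).
by rewrite xsectionE.
Qed.

(** Counts low scores upwards and the remaining trials downwards, so that the
    potential can be read off the state; the walk stops when no trial remains. *)
Definition count_step (q : nfit.-tuple 'cV[R]_d * (nat * nat) * 'cV[R]_d) :
    nfit.-tuple 'cV[R]_d * (nat * nat) :=
  if (0 < q.1.2.2)%N
  then (q.1.1, (if low_score q.1.1 q.2 then q.1.2.1.+1 else q.1.2.1, q.1.2.2.-1))
  else q.1.

Lemma measurable_count_step : measurable_fun
  [set: nfit.-tuple 'cV[R]_d * (nat * nat) * 'cV[R]_d] count_step.
Proof.
pose Q := (nfit.-tuple 'cV[R]_d * (nat * nat) * 'cV[R]_d)%type.
have m1 : measurable_fun [set: Q] (fun q => q.1) by exact: measurable_fst.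
have m11 : measurable_fun [set: Q] (fun q => q.1.1).
  exact: (measurableT_comp measurable_fst m1).
have m12 : measurable_fun [set: Q] (fun q => q.1.2).
  exact: (measurableT_comp measurable_snd m1).
have m121 : measurable_fun [set: Q] (fun q => q.1.2.1).
  exact: (measurableT_comp measurable_fst m12).
have m122 : measurable_fun [set: Q] (fun q => q.1.2.2).
  exact: (measurableT_comp measurable_snd m12).
have m2 : measurable_fun [set: Q] (fun q => q.2) by exact: measurable_snd.
apply: measurable_fun_ifT => //; first exact: measurable_fun_ltn.
apply: measurable_fun_pair => //; apply: measurable_fun_pair.
  apply: measurable_fun_ifT => //.
    exact: (measurableT_comp measurable_low_score (measurable_fun_pair m11 m2)).
  exact: (measurableT_comp (_ : measurable_fun _ succn) m121).
exact: (measurableT_comp (_ : measurable_fun _ predn) m122).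
Qed.

Lemma foldl_count_step (D : nfit.-tuple 'cV[R]_d) a (cs : seq 'cV[R]_d) :
  foldl (fun x t => count_step (x, t)) (D, (a, size cs)) cs =
  (D, ((a + count (low_score D) cs)%N, 0%N)).
Proof.
elim: cs a => [|c cs IHcs] a /=; first by rewrite addn0.
by rewrite {2}/count_step /=; case: (low_score D c); rewrite IHcs ?addSn ?addnS.
Qed.

Definition tail_potential (x : nfit.-tuple 'cV[R]_d * (nat * nat)) : R :=
  tail rho x.2.2 (k - x.2.1).

Lemma measurable_tail_potential :
  measurable_fun [set: nfit.-tuple 'cV[R]_d * (nat * nat)] tail_potential.
Proof.
pose Q := (nfit.-tuple 'cV[R]_d * (nat * nat))%type.
have m21 : measurable_fun [set: Q] (fun q => q.2.1).
  exact: (measurableT_comp measurable_fst measurable_snd).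
apply: (measurable_fun_nat_case (g := fun q : Q => q.2.2)
  (f := fun r (q : Q) => tail rho r (k - q.2.1))).
  exact: (measurableT_comp measurable_snd measurable_snd).
move=> r.
exact: (measurableT_comp (_ : measurable_fun _ (fun a => tail rho r (k - a)%N)) m21).
Qed.

(** A low score has probability at most [1 - rho], and the tail is larger after a
    low score ([tail_anti]), so the recursion defining [tail] is an upper bound. *)
Lemma tail_potential_drift x :
  (\int[Pc]_c (tail_potential (count_step (x, c)))%:E <= 1%:E * (tail_potential x)%:E)%E.
Proof.
have r01 : 0 <= rho <= 1 by case/andP: hrho => *; rewrite !ltW.
have tail_potential_ge0 y : 0 <= tail_potential y by exact: tail_ge0.
rewrite mul1e; case: x => [D [a [|r]]].
  rewrite (eq_integral (fun=> (tail_potential (D, (a, 0%N)))%:E)); last by [].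
  rewrite integral_cst// -[leRHS]mule1; apply: lee_wpmul2l.
    by rewrite lee_fin.
  exact: probability_le1.
have mf : measurable_fun [set: 'cV[R]_d] (fun c => (tail_potential (count_step (D, (a, r.+1), c)))%:E).
  apply/measurable_EFinP; apply: (measurableT_comp measurable_tail_potential).
  by apply: (measurableT_comp measurable_count_step); exact: pair1_measurable.
have mL : measurable [set c | low_score D c].
  have := measurable_set_of measurable_low_score => /(measurable_xsection D).
  by rewrite xsectionE.
have := @integral_le_three _ _ _ Pc [set c | low_score D c] [set c | low_score D c] _
  (tail rho r (k - a.+1)) 0 (tail rho r (k - a)) mL mL _ mf.
move=> h; apply: (le_trans (h _ _ _ _ _)) => //.
- by move=> c; rewrite lee_fin.
- by move=> c /= lc; rewrite /tail_potential /count_step /= lc.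
- by move=> c /= /negP/negbTE lc; rewrite /tail_potential /count_step /= lc.
rewrite lee_fin subrr mulr0 addr0 /tail_potential /=.
have : fine (Pc [set c | low_score D c]) <= 1 - rho.
  rewrite -lee_fin fineK; first exact: low_score_prob.
  exact: fin_num_measure.
have : 0 <= fine (Pc [set c | low_score D c]) by exact/fine_ge0/measure_ge0.
move: (fine _) => q q0 q1.
have -> : (k - a.+1 = (k - a).-1)%N by rewrite subnS.
case: (k - a)%N => [|j] /=; first by rewrite !tail0; lra.
have := tail_anti r j r01; nra.
Qed.

(** A finite threshold whose sublevel set is too small is a low level, and then so
    are the [k] smallest calibration scores. *)
Lemma calibrated_miss D (cal : m.-tuple 'cV[R]_d) :
  ~ tolerance_event Pc rho (calibrated_set rho delta0 (s D) cal) ->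
  (k <= count (low_score D) cal)%N.
Proof.
have [hk0 _] : (0 < k)%N /\ tail rho m k <= delta0.
  by apply: k_calP => //; case/andP: hdelta0.
move=> ntol; have [[e _]|[t [e ct]]] := order_stat_fin [seq s D x | x <- cal] k.
  exfalso; apply: ntol; rewrite /tolerance_event.
  rewrite (_ : ~` _ = set0) ?measure0 ?lee_fin; first by case/andP: hrho => /ltW.
  apply/seteqP; split => // c; apply.
  by rewrite /calibrated_set /= -/k e leey.
have Ce : calibrated_set rho delta0 (s D) cal = [set c | s D c <= t].
  by apply/seteqP; split => c; rewrite /calibrated_set /= -/k e lee_fin.
have tlow : (cdf_at Pc (s D) t < (1 - rho)%:E)%E.
  rewrite ltNge; apply/negP => Ft; apply: ntol; rewrite /tolerance_event Ce.
  have mL := measurable_level (measurable_score D) t.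
  move: Ft; rewrite /cdf_at probability_setC//.
  have PL : Pc [set c | s D c <= t] \is a fin_num by exact: fin_num_measure.
  rewrite -(fineK PL) -EFinB !lee_fin; lra.
rewrite -(prednK hk0) (leq_trans ct)// count_map; apply: sub_count => c /= ct'.
by apply/asboolP; apply: le_lt_trans tlow; apply: cdf_at_le ct'; exact: measurable_score.
Qed.

Lemma convex_calibrated (D : nfit.-tuple 'cV[R]_d) (cal : m.-tuple 'cV[R]_d) :
  (forall t, convex_set ([set c | s D c <= t] : set (convex_lmodType 'cV[R]_d))) ->
  convex_set (calibrated_set rho delta0 (s D) cal : set (convex_lmodType 'cV[R]_d)).
Proof.
move=> cs; have [[e _]|[t [e _]]] := order_stat_fin [seq s D x | x <- cal] k.
  by move=> x y l _ _; rewrite inE /calibrated_set /= -/k e leey.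
have -> : calibrated_set rho delta0 (s D) cal = [set c | s D c <= t].
  by apply/seteqP; split => c; rewrite /calibrated_set /= -/k e lee_fin.
exact: cs.
Qed.

Lemma measurable_calibrated : measurable
  [set q : nfit.-tuple 'cV[R]_d * m.-tuple 'cV[R]_d * 'cV[R]_d |
    calibrated_set rho delta0 (s q.1.1) q.1.2 q.2].
Proof.
have [hk0 _] : (0 < k)%N /\ tail rho m k <= delta0.
  by apply: k_calP => //; case/andP: hdelta0.
pose Q := (nfit.-tuple 'cV[R]_d * m.-tuple 'cV[R]_d * 'cV[R]_d)%type.
pose f (q : Q) : R := \sum_(j < m)
  (if s q.1.1 (tnth q.1.2 j) < s q.1.1 q.2 then 1 else 0).
have mfit : measurable_fun [set: Q] (fun q => q.1.1).
  exact: (measurableT_comp measurable_fst measurable_fst).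
have mcal : measurable_fun [set: Q] (fun q => q.1.2).
  exact: (measurableT_comp measurable_snd measurable_fst).
have mf : measurable_fun [set: Q] f.
  apply: measurable_sum => j; apply: measurable_fun_ifT => //.
  apply: measurable_fun_ltr.
    have mj : measurable_fun [set: Q] (fun q => tnth q.1.2 j).
      exact: (measurableT_comp (measurable_tnth j) mcal).
    exact: (measurableT_comp ms (measurable_fun_pair mfit mj)).
  exact: (measurableT_comp ms (measurable_fun_pair mfit measurable_snd)).
rewrite [X in measurable X](_ : _ = [set q | f q < k%:R]).
  by apply: (@measurable_set_of _ _ (fun q => f q < k%:R)); exact: measurable_fun_ltr.
apply/seteqP; suff fE (q : Q) : f q = (count (fun y => (y < s q.1.1 q.2)%R)
    [seq s q.1.1 x | x <- q.1.2])%:R.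
  by split=> q; rewrite /calibrated_set /= fE ltr_nat => /(order_statP _ _ hk0).
rewrite /f count_map -sum1_count natr_sum [RHS]big_mkcond [RHS]big_tuple.
by apply: eq_bigr => j _; rewrite mulr1n.
Qed.

Context {dO : measure_display} {Omega : measurableType dO}.
Context (P : probability Omega R) (pilot : 'I_(nfit + m) -> {RV P >-> 'cV[R]_d}).
Hypothesis hpilot : iid Pc pilot.

Let fit w := [tuple pilot (lshift m i) w | i < nfit].
Let cal w := [tuple pilot (rshift nfit j) w | j < m].
Let lcal := [seq rshift nfit j | j <- enum 'I_m].

Lemma calibration_count :
  measurable [set w | (k <= count (low_score (fit w)) (cal w))%N] /\
  (P [set w | (k <= count (low_score (fit w)) (cal w))%N] <= delta0%:E)%E.
Proof.
have ul : uniq ([seq lshift m i | i <- enum 'I_nfit] ++ lcal).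
  rewrite cat_uniq; apply/and3P; split.
  - by rewrite (map_inj_uniq (@lshift_inj _ _)) enum_uniq.
  - apply/hasPn => _ /mapP[j _ ->]; apply/negP => /mapP[i _ /eqP].
    by rewrite eq_rlshift.
  - by rewrite /lcal (map_inj_uniq (@rshift_inj _ _)) enum_uniq.
pose s0 w := (fit w, (0%N, m)).
have fs0 : fresh Pc pilot s0 lcal.
  have := fresh_tuple hpilot ul.
  by apply: (fresh_comp (f := fun D : nfit.-tuple 'cV[R]_d => (D, (0%N, m))));
    exact: measurable_fun_pair.
have ulc : uniq lcal by move: ul; rewrite cat_uniq => /and3P[].
have mc := measurable_count_step.
have mV : measurable_fun [set: nfit.-tuple 'cV[R]_d * (nat * nat)] (EFin \o tail_potential).
  by apply/measurable_EFinP; exact: measurable_tail_potential.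
have r01 : 0 <= rho <= 1 by case/andP: hrho => *; rewrite !ltW.
have wE w : walk pilot count_step s0 lcal w = (fit w, (count (low_score (fit w)) (cal w), 0%N)).
  have szc : m = size (cal w) by rewrite size_tuple.
  rewrite /walk /s0 {1}szc -(foldl_count_step (fit w) 0 (cal w)); congr foldl.
  by rewrite /lcal -map_comp.
have := @fresh_walk _ _ _ P _ _ Pc _ pilot _ _ _ mc s0 lcal [::].
rewrite cats0 => /(_ ulc fs0)[mw _].
have mE : measurable [set w | (k <= count (low_score (fit w)) (cal w))%N].
  have mcount : measurable_fun [set: Omega] (fun w => count (low_score (fit w)) (cal w)).
    have := measurableT_comp measurable_fst (measurableT_comp measurable_snd mw).
    by apply: eq_measurable_fun => w _ /=; rewrite wE.
  apply: (@measurable_set_of _ _ (fun w => (k <= count (low_score (fit w)) (cal w))%N)).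
  exact: measurable_fun_leq.
split=> //.
have := @integral_walk_le _ _ _ P _ _ Pc _ pilot _ _ _ mc (EFin \o tail_potential)
  1 s0 lcal ler01 mV _ tail_potential_drift ulc fs0.
move=> h2.
rewrite -[leLHS]mul1e.
apply: le_trans (@markov_set _ _ _ P _ (fun w => tail_potential (walk pilot count_step s0 lcal w))
  1 ler01 mE _ _ _) _.
- by apply/measurable_EFinP; exact: (measurableT_comp mV mw).
- by move=> w; exact: tail_ge0.
- move=> w kw; rewrite wE /tail_potential /=.
  by move: kw; rewrite /= -subn_eq0 => /eqP ->.
apply: le_trans (h2 _) _; first by move=> x; rewrite lee_fin tail_ge0.
rewrite expr1n mul1e (eq_integral (fun=> (tail rho m k)%:E)); last first.
  by move=> w _; rewrite /= /tail_potential /= subn0.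
have [_ kd] : (0 < k)%N /\ tail rho m k <= delta0.
  by apply: k_calP => //; case/andP: hdelta0.
rewrite integral_cst//.
apply: (@le_trans _ _ ((tail rho m k)%:E * 1)%E).
  by apply: lee_wpmul2l; [rewrite lee_fin tail_ge0|exact: probability_le1].
by rewrite mule1 lee_fin.
Qed.

Lemma calibrated_estimated_prior
    (W : {RV P >-> (nfit.-tuple 'cV[R]_d * m.-tuple 'cV[R]_d)%type}) :
  (forall w, W w = (fit w, cal w)) ->
  (forall D t, convex_set ([set c | s D c <= t]
     : set (convex_lmodType 'cV[R]_d))) ->
  estimated_prior Pc rho delta0 W
    (fun D => calibrated_set rho delta0 (s D.1) D.2).
Proof.
move=> WE cs; split.
- exact: measurable_calibrated.
- by move=> D; exact: convex_calibrated.
have [mE PE] := calibration_count; set E := [set w | _] in mE PE.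
have mT : measurable [set w | tolerance_event Pc rho
    (calibrated_set rho delta0 (s (W w).1) (W w).2)].
  have := measurable_funPT W measurableT _
    (@measurable_tolerance _ _ Pc rho _ _
      (fun D : nfit.-tuple 'cV[R]_d * m.-tuple 'cV[R]_d =>
        calibrated_set rho delta0 (s D.1) D.2) measurable_calibrated).
  by rewrite setTI.
apply: (@le_trans _ _ (P (~` E))).
  rewrite probability_setC//.
  have PEf : P E \is a fin_num by exact: fin_num_measure.
  by move: PE; rewrite -(fineK PEf) -EFinB !lee_fin; lra.
apply: le_measure; rewrite ?inE//; first exact: measurableC.
move=> w nE; apply: contrapT => ntol; apply: nE.
by move: ntol => /=; rewrite WE => /calibrated_miss.
Qed.

End calibration.

Theorem theorem7 (R : realType) (d p : nat) (A : 'M[R]_(p, d)) (b : 'cV[R]_p)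
    (hne : polyhedron A b !=set0) (hbd : bounded_set (polyhedron A b))
    (Pc : probability 'cV[R]_d R) (rho delta0 : R)
    (hrho : 0 < rho < 1) (hdelta0 : 0 < delta0 < 1)
    (n1 : nat) (hn1 : (1 <= n1)%N)
    (pick : @rule R d) (hpick : tie_breaking (polyhedron A b) pick) :
  (forall (dO dW : measure_display) (Omega : measurableType dO)
     (Wt : measurableType dW) (P : probability Omega R) (W : {RV P >-> Wt})
     (C : Wt -> set 'cV[R]_d),
     estimated_prior Pc rho delta0 W C ->
     learning_guarantee (polyhedron A b) Pc rho delta0 pick n1 W C)
  /\
  (forall (dO : measure_display) (Omega : measurableType dO)
     (P : probability Omega R) (nfit m : nat)
     (pilot : 'I_(nfit + m) -> {RV P >-> 'cV[R]_d})
     (W : {RV P >-> (nfit.-tuple 'cV[R]_d * m.-tuple 'cV[R]_d)%type})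
     (s : nfit.-tuple 'cV[R]_d -> 'cV[R]_d -> R),
     iid Pc pilot ->
     (forall w, W w = ([tuple pilot (lshift m i) w | i < nfit],
                       [tuple pilot (rshift nfit j) w | j < m])) ->
     measurable_fun [set: nfit.-tuple 'cV[R]_d * 'cV[R]_d]
       (fun q => s q.1 q.2) ->
     (forall D t, convex_set ([set c | s D c <= t]
                                : set (convex_lmodType 'cV[R]_d))) ->
     learning_guarantee (polyhedron A b) Pc rho delta0 pick n1 W
       (fun D => calibrated_set rho delta0 (s D.1) D.2)).
Proof.
have part1 := @estimated_prior_guarantee R d p A b hne hbd pick hpick Pc rho
  delta0 n1 hrho hn1.
split=> [dO dW Omega Wt P W C|dO Omega P nfit m pilot W s hp WE ms cs].
  exact: part1.
apply: part1; exact: (calibrated_estimated_prior hrho hdelta0 ms hp).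
Qed.
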